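(* Let $\alpha>0$, $T_0>0$, and let $u$ be a smooth solution of the equivariant Skyrme equation \[ \Big(1+\tfrac{\alpha^2\sin^2u}{r^2}\Big)(u_{tt}-u_{rr}) - \Big(1-\tfrac{\alpha^2\sin^2u}{r^2}\Big)\tfrac{u_r}{r} + \tfrac{\sin 2u}{2r^2}\big[\alpha^2(u_t^2-u_r^2)+1\big]=0 \] in $\Omega=\{(t,r):0<t\le T_0,\ 0\le r\le t\}$ (for $r>0$), with $u(t,0)=0$. Then the energy does not concentrate at the origin: \[ \lim_{T\to0^+}\int_0^T\Big[\Big(1+\tfrac{\alpha^2\sin^2u(T,r)}{r^2}\Big)\tfrac{u_t(T,r)^2+u_r(T,r)^2}{2}+\tfrac{\sin^2u(T,r)}{2r^2}\Big]\,r\,dr=0. \]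
   Context: $u=u(t,r)$ is the longitudinal angle of a co-rotational (index 1) equivariant map $U(t,r,\omega)=(u(t,r),\omega)$ from $\mathbb{R}^{2+1}$ to $\mathbb{S}^2$, where $(r,\omega)$ are polar coordinates on $\mathbb{R}^2$; ''smooth solution in $\Omega$'' means $u$ is smooth on $\Omega$, satisfies the equation for $r>0$, and $u(t,0)=0$. *)

(* Defs.v *)
From Stdlib Require Import Reals.
Open Scope R_scope.

Definition open2 (U : R -> R -> Prop) : Prop :=
  forall t r, U t r -> exists d, 0 < d /\
    forall t' r', Rabs (t' - t) < d -> Rabs (r' - r) < d -> U t' r'.

Definition cont2_at (f : R -> R -> R) (t r : R) : Prop :=
  forall eps, 0 < eps -> exists d, 0 < d /\
    forall t' r', Rabs (t' - t) < d -> Rabs (r' - r) < d ->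
      Rabs (f t' r' - f t r) < eps.

(* D i j = partial derivative d^i/dt^i d^j/dr^j of D 0 0, all of them
   existing and jointly continuous on U: i.e. D 0 0 is C^infinity on U
   and D is its family of partial derivatives. *)
Definition smooth_family (U : R -> R -> Prop) (D : nat -> nat -> R -> R -> R)
  : Prop :=
  forall i j t r, U t r ->
    derivable_pt_lim (fun s => D i j s r) t (D (S i) j t r) /\
    derivable_pt_lim (fun s => D i j t s) r (D i (S j) t r) /\
    cont2_at (D i j) t r.

Definition Omega (T0 t r : R) : Prop := 0 < t <= T0 /\ 0 <= r <= t.

Definition smooth_on_Omega (T0 : R) (u : R -> R -> R)
  (D : nat -> nat -> R -> R -> R) : Prop :=
  exists U : R -> R -> Prop, open2 U /\
    (forall t r, Omega T0 t r -> U t r) /\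
    smooth_family U D /\
    (forall t r, U t r -> D 0%nat 0%nat t r = u t r).

Definition skyrme_eq (alpha : R) (D : nat -> nat -> R -> R -> R) (t r : R)
  : Prop :=
  let u := D 0%nat 0%nat t r in
  let ut := D 1%nat 0%nat t r in
  let ur := D 0%nat 1%nat t r in
  let utt := D 2%nat 0%nat t r in
  let urr := D 0%nat 2%nat t r in
  (1 + alpha ^ 2 * sin u ^ 2 / r ^ 2) * (utt - urr)
  - (1 - alpha ^ 2 * sin u ^ 2 / r ^ 2) * (ur / r)
  + sin (2 * u) / (2 * r ^ 2) * (alpha ^ 2 * (ut ^ 2 - ur ^ 2) + 1) = 0.

Definition energy_density (alpha : R) (D : nat -> nat -> R -> R -> R)
  (T r : R) : R :=
  let u := D 0%nat 0%nat T r in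
  let ut := D 1%nat 0%nat T r in
  let ur := D 0%nat 1%nat T r in
  ((1 + alpha ^ 2 * sin u ^ 2 / r ^ 2) * ((ut ^ 2 + ur ^ 2) / 2)
   + sin u ^ 2 / (2 * r ^ 2)) * r.

(* Main.v *)
(** Write [F = 1 + alpha^2 sin^2 u / r^2] and let [E t] be the energy on the slice
    of the cone at time [t]. Energy conservation makes [E] nondecreasing with
    [E' =] flux through [r = t], so [E t] has a limit as [t -> 0] and the flux
    over [(0, t)] tends to [0].

    The quartic term of the energy bounds [sin u u_r], the derivative of
    [1 - cos u], so [1 - cos u <= K r] uniformly: [u] is small near the tip and
    [sin^2 u / r] is a lower order term.

    In the exterior region [lam T <= r <= T] the energy tends to [0]: in null
    coordinates the two quantities [r F (u_t +- u_r)^2 / 2] satisfy a coupled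
    transport system with coefficients [O(1/r)], and a weight that is monotone
    in both null directions absorbs the coupling and propagates smallness from
    the cone and from a fixed later time.

    In the interior, the multiplier [-9 r u_r - 4 sin u / F + sin u] yields a
    density [morawetz] whose integral over a slice is [o(t)] and whose
    source dominates [2 e] up to lower order terms. Integrating over [T, 2 T]
    gives [2 T E(T) = o(T)]. *)

Require Import Defs.
From Stdlib Require Import Reals Lra Classical.
From Coquelicot Require Import Coquelicot.
Open Scope R_scope.

(** * Compactness and calculus in two variables *)

(** No double integral occurs. Each space-time estimate says that a function of one variable is
    nondecreasing: a slice integral, plus a multiple of [E] whose derivative pays for the flux
    through the cone, plus a linear term for the lower order errors. The densities contain [1/r], so
    the balance laws are used on [r > 0] only. Slices are cut at [r = eps], the terms at the cut are
    [O(eps)] because [u] vanishes on the axis, and [eps] tends to [0] at the end. The constants in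
    these [O(eps)] degenerate at the tip, hence the restriction to time windows [[a, b]] with
    [a > 0]. The Morawetz density has size [r e], and integrates to [O(t)] times the energy, which
    alone is not enough. It is [o(t)] only if the energy sits at [r] much smaller than [t], which is
    why exterior decay has to be proved beforehand. A single parameter [lam] separates the two
    regions and is also the size of all the errors. *)

(** Continuous induction: the supremum of the points reachable from [a] is itself reachable, and
    must be [b]. It replaces open covers in the two compactness arguments below. *)
Lemma cousin (Q : R -> R -> Prop) (a b : R) :
  a <= b ->
  (forall c x d, a <= c -> c <= x -> x <= d -> d <= b ->
     Q c x -> Q x d -> Q c d) ->
  (forall x, a <= x <= b -> exists d, 0 < d /\
     forall p q, a <= p -> p <= x -> x <= q -> q <= b ->
       x - d < p -> q < x + d -> Q p q) ->
  Q a b.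
Proof.
  intros Hab Hcat Hloc.
  set (S := fun x => a <= x <= b /\ Q a x).
  assert (HSa : S a).
  { split; [lra|]. destruct (Hloc a) as [d [Hd H]]; [lra|]. apply H; lra. }
  destruct (completeness S) as [m [Hub Hlub]].
  { exists b. intros x [Hx _]. lra. }
  { exists a. exact HSa. }
  assert (Ham : a <= m) by (apply Hub; exact HSa).
  assert (Hmb : m <= b) by (apply Hlub; intros x [Hx _]; lra).
  destruct (Hloc m) as [d [Hd H]]; [lra|].
  assert (Hex : exists x, S x /\ m - d < x).
  { apply NNPP. intro Hn.
    assert (m <= m - d); [|lra].
    apply Hlub. intros x Hx. destruct (Rle_dec x (m - d)) as [?|Hgt]; [assumption|].
    exfalso. apply Hn. exists x. split; [exact Hx|lra]. }
  destruct Hex as [x [[Hx HQ] Hxd]].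
  assert (Hxm : x <= m) by (apply Hub; split; assumption).
  set (q := Rmin b (m + d / 2)).
  assert (Hq1 : q <= b) by apply Rmin_l.
  assert (Hq2 : q <= m + d / 2) by apply Rmin_r.
  assert (Hq3 : m <= q) by (apply Rmin_glb; lra).
  assert (HSq : S q).
  { split; [lra|]. apply (Hcat a x q); try lra; [exact HQ|]. apply H; lra. }
  assert (q <= m) by (apply Hub; exact HSq).
  replace b with q; [apply HSq|].
  destruct (Rle_dec b (m + d / 2)) as [Hle|Hgt].
  - unfold q. apply Rmin_left; lra.
  - exfalso. assert (q = m + d / 2) by (unfold q; apply Rmin_right; lra). lra.
Qed.

(** The margin [d] beyond both endpoints is what a slice with moving endpoints requires: at nearby
    times it leaves [[a, b]] a little. *)
Lemma tube (P : R -> R -> Prop) (t a b : R) :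
  open2 P -> a <= b -> (forall r, a <= r <= b -> P t r) ->
  exists d, 0 < d /\
    forall t' r, Rabs (t' - t) < d -> a - d < r < b + d -> P t' r.
Proof.
  intros Hopen Hab HP.
  destruct (Hopen t a) as [da [Hda Ha]]; [apply HP; lra|].
  destruct (Hopen t b) as [db [Hdb Hb]]; [apply HP; lra|].
  assert (HQ : exists d, 0 < d /\ forall t' r, Rabs (t' - t) < d -> a <= r <= b -> P t' r).
  { apply (cousin (fun c e => exists d, 0 < d /\
      forall t' r, Rabs (t' - t) < d -> c <= r <= e -> P t' r)); [exact Hab| |].
    - intros c x e _ _ _ _ [d1 [Hd1 H1]] [d2 [Hd2 H2]].
      exists (Rmin d1 d2). split; [apply Rmin_pos; assumption|].
      intros t' r Ht Hr.
      destruct (Rle_dec r x).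
      + apply H1; [|lra]. eapply Rlt_le_trans; [exact Ht|apply Rmin_l].
      + apply H2; [|lra]. eapply Rlt_le_trans; [exact Ht|apply Rmin_r].
    - intros x Hx. destruct (Hopen t x (HP x Hx)) as [d [Hd H]].
      exists d. split; [exact Hd|]. intros p q _ _ _ _ Hp Hq.
      exists d. split; [exact Hd|]. intros t' r Ht Hr. apply H; [exact Ht|].
      apply Rabs_def1; lra. }
  destruct HQ as [d [Hd H]].
  exists (Rmin d (Rmin da db)). split; [repeat apply Rmin_pos; assumption|].
  intros t' r Ht Hr.
  assert (Hm1 := Rmin_l d (Rmin da db)).
  assert (Hm2 := Rmin_r d (Rmin da db)).
  assert (Hm3 := Rmin_l da db). assert (Hm4 := Rmin_r da db).
  destruct (Rlt_dec r a); [apply Ha; [lra|apply Rabs_def1; lra]|].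
  destruct (Rlt_dec b r); [apply Hb; [lra|apply Rabs_def1; lra]|].
  apply H; lra.
Qed.

Lemma bounded_on_rectangle (f : R -> R -> R) (a b c d : R) :
  a <= b -> c <= d ->
  (forall t r, a <= t <= b -> c <= r <= d -> continuity_2d_pt f t r) ->
  exists M, 0 < M /\ forall t r, a <= t <= b -> c <= r <= d -> Rabs (f t r) <= M.
Proof.
  intros Hab Hcd Hf.
  apply (cousin (fun a' b' => exists M, 0 < M /\
    forall t r, a' <= t <= b' -> c <= r <= d -> Rabs (f t r) <= M)); [exact Hab| |].
  - intros a' x b' _ _ _ _ [M1 [HM1 H1]] [M2 [HM2 H2]].
    exists (M1 + M2). split; [lra|]. intros t r Ht Hr.
    destruct (Rle_dec t x).
    + specialize (H1 t r). lra.
    + specialize (H2 t r). lra.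
  - intros t0 Ht0.
    assert (HQ : exists M e, 0 < M /\ 0 < e /\
      forall t r, Rabs (t - t0) < e -> c <= r <= d -> Rabs (f t r) <= M).
    { apply (cousin (fun p q => exists M e, 0 < M /\ 0 < e /\
        forall t r, Rabs (t - t0) < e -> p <= r <= q -> Rabs (f t r) <= M));
        [exact Hcd| |].
      - intros p x q _ _ _ _ [M1 [e1 [HM1 [He1 H1]]]] [M2 [e2 [HM2 [He2 H2]]]].
        exists (M1 + M2), (Rmin e1 e2).
        split; [lra|]. split; [apply Rmin_pos; assumption|].
        intros t r Ht Hr. assert (Hl := Rmin_l e1 e2). assert (Hr' := Rmin_r e1 e2).
        destruct (Rle_dec r x).
        + specialize (H1 t r). lra.
        + specialize (H2 t r). lra.
      - intros r0 Hr0. destruct (Hf t0 r0 Ht0 Hr0 (mkposreal 1 Rlt_0_1)) as [e He].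
        simpl in He. exists e. split; [apply cond_pos|].
        intros p q _ _ _ _ Hp Hq.
        exists (Rabs (f t0 r0) + 1), e.
        split; [assert (H := Rabs_pos (f t0 r0)); lra|]. split; [apply cond_pos|].
        intros t r Ht Hr.
        assert (H : Rabs (f t r - f t0 r0) < 1)
          by (apply He; [exact Ht|apply Rabs_def1; lra]).
        replace (f t r) with (f t0 r0 + (f t r - f t0 r0)) by ring.
        eapply Rle_trans; [apply Rabs_triang|]. lra. }
    destruct HQ as [M [e [HM [He H]]]].
    exists e. split; [exact He|]. intros p q _ _ _ _ Hp Hq.
    exists M. split; [exact HM|]. intros t r Ht Hr. apply H; [|exact Hr].
    apply Rabs_def1; lra.
Qed.

(** * Calculus of continuously differentiable functions of two variables *)

Lemma open2_and (U V : R -> R -> Prop) :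
  open2 U -> open2 V -> open2 (fun t r => U t r /\ V t r).
Proof.
  intros HU HV t r [Ht Hr].
  destruct (HU t r Ht) as [d1 [Hd1 H1]]. destruct (HV t r Hr) as [d2 [Hd2 H2]].
  exists (Rmin d1 d2). split; [apply Rmin_pos; assumption|].
  intros t' r' Ht' Hr'.
  assert (Hl := Rmin_l d1 d2). assert (Hr'' := Rmin_r d1 d2).
  split; [apply H1|apply H2]; lra.
Qed.

(** The partial derivatives are explicit arguments, so that the closure lemmas compute them and
    every balance law becomes a rational identity in the values of [D], [sin u] and [cos u]. *)
Definition C1on (W : R -> R -> Prop) (f ft fr : R -> R -> R) : Prop :=
  forall t r, W t r ->
    is_derive (fun x => f x r) t (ft t r) /\
    is_derive (fun x => f t x) r (fr t r) /\
    continuity_2d_pt f t r /\ continuity_2d_pt ft t r /\ continuity_2d_pt fr t r.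

Section C1on_closure.
Variable W : R -> R -> Prop.

Lemma C1on_const (c : R) : C1on W (fun _ _ => c) (fun _ _ => 0) (fun _ _ => 0).
Proof.
  intros t r _.
  split; [apply (@is_derive_const R_AbsRing)|].
  split; [apply (@is_derive_const R_AbsRing)|].
  repeat split; apply continuity_2d_pt_const.
Qed.

Lemma C1on_fst : C1on W (fun t _ => t) (fun _ _ => 1) (fun _ _ => 0).
Proof.
  intros t r _.
  split; [apply (@is_derive_id R_AbsRing)|].
  split; [apply (@is_derive_const R_AbsRing)|].
  split; [apply continuity_2d_pt_id1|split; apply continuity_2d_pt_const].
Qed.

Lemma C1on_snd : C1on W (fun _ r => r) (fun _ _ => 0) (fun _ _ => 1).
Proof.
  intros t r _.
  split; [apply (@is_derive_const R_AbsRing)|].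
  split; [apply (@is_derive_id R_AbsRing)|].
  split; [apply continuity_2d_pt_id2|split; apply continuity_2d_pt_const].
Qed.

Lemma C1on_plus f ft fr g gt gr : C1on W f ft fr -> C1on W g gt gr ->
  C1on W (fun t r => f t r + g t r) (fun t r => ft t r + gt t r)
    (fun t r => fr t r + gr t r).
Proof.
  intros Hf Hg t r H.
  destruct (Hf t r H) as [F1 [F2 [F3 [F4 F5]]]].
  destruct (Hg t r H) as [G1 [G2 [G3 [G4 G5]]]].
  split; [exact (is_derive_plus _ _ _ _ _ F1 G1)|].
  split; [exact (is_derive_plus _ _ _ _ _ F2 G2)|].
  repeat split; apply continuity_2d_pt_plus; assumption.
Qed.

Lemma C1on_minus f ft fr g gt gr : C1on W f ft fr -> C1on W g gt gr ->
  C1on W (fun t r => f t r - g t r) (fun t r => ft t r - gt t r)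
    (fun t r => fr t r - gr t r).
Proof.
  intros Hf Hg t r H.
  destruct (Hf t r H) as [F1 [F2 [F3 [F4 F5]]]].
  destruct (Hg t r H) as [G1 [G2 [G3 [G4 G5]]]].
  split; [exact (is_derive_minus _ _ _ _ _ F1 G1)|].
  split; [exact (is_derive_minus _ _ _ _ _ F2 G2)|].
  repeat split; apply continuity_2d_pt_minus; assumption.
Qed.

Lemma C1on_mult f ft fr g gt gr : C1on W f ft fr -> C1on W g gt gr ->
  C1on W (fun t r => f t r * g t r) (fun t r => ft t r * g t r + f t r * gt t r)
    (fun t r => fr t r * g t r + f t r * gr t r).
Proof.
  intros Hf Hg t r H.
  destruct (Hf t r H) as [F1 [F2 [F3 [F4 F5]]]].
  destruct (Hg t r H) as [G1 [G2 [G3 [G4 G5]]]].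
  split; [exact (is_derive_mult _ _ _ _ _ F1 G1 Rmult_comm)|].
  split; [exact (is_derive_mult _ _ _ _ _ F2 G2 Rmult_comm)|].
  repeat split; try apply continuity_2d_pt_plus; apply continuity_2d_pt_mult; assumption.
Qed.

Lemma C1on_inv f ft fr : (forall t r, W t r -> f t r <> 0) -> C1on W f ft fr ->
  C1on W (fun t r => / f t r) (fun t r => - ft t r * (/ f t r * / f t r))
    (fun t r => - fr t r * (/ f t r * / f t r)).
Proof.
  intros Hn Hf t r H.
  destruct (Hf t r H) as [F1 [F2 [F3 [F4 F5]]]].
  assert (H0 := Hn t r H).
  split.
  { evar_last; [exact (is_derive_inv _ _ _ F1 H0)|simpl; field; exact H0]. }
  split.
  { evar_last; [exact (is_derive_inv _ _ _ F2 H0)|simpl; field; exact H0]. }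
  split; [apply continuity_2d_pt_inv; assumption|].
  split; (apply continuity_2d_pt_mult; [apply continuity_2d_pt_opp; assumption|];
    apply continuity_2d_pt_mult; apply continuity_2d_pt_inv; assumption).
Qed.

Lemma C1on_comp (k dk : R -> R) f ft fr :
  (forall x, is_derive k x (dk x)) -> (forall x, continuity_pt dk x) ->
  C1on W f ft fr ->
  C1on W (fun t r => k (f t r)) (fun t r => ft t r * dk (f t r))
    (fun t r => fr t r * dk (f t r)).
Proof.
  intros Hk Hdk Hf t r H.
  destruct (Hf t r H) as [F1 [F2 [F3 [F4 F5]]]].
  split; [exact (is_derive_comp k (fun x => f x r) t _ _ (Hk _) F1)|].
  split; [exact (is_derive_comp k (fun x => f t x) r _ _ (Hk _) F2)|].
  split.
  { apply continuity_1d_2d_pt_comp; [|exact F3].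
    apply derivable_continuous_pt. exists (dk (f t r)). apply is_derive_Reals, Hk. }
  split; (apply continuity_2d_pt_mult; [assumption|];
    apply continuity_1d_2d_pt_comp; [apply Hdk|exact F3]).
Qed.

Lemma C1on_sin f ft fr : C1on W f ft fr ->
  C1on W (fun t r => sin (f t r)) (fun t r => ft t r * cos (f t r))
    (fun t r => fr t r * cos (f t r)).
Proof.
  apply (C1on_comp sin cos); [apply is_derive_sin|apply continuity_cos].
Qed.

Lemma C1on_exp f ft fr : C1on W f ft fr ->
  C1on W (fun t r => exp (f t r)) (fun t r => ft t r * exp (f t r))
    (fun t r => fr t r * exp (f t r)).
Proof.
  apply (C1on_comp exp exp); [apply is_derive_exp|].
  intro x. apply derivable_continuous_pt, derivable_pt_exp.
Qed.

Lemma C1on_sqr f ft fr : C1on W f ft fr ->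
  C1on W (fun t r => f t r ^ 2) (fun t r => ft t r * (2 * f t r))
    (fun t r => fr t r * (2 * f t r)).
Proof.
  apply (C1on_comp (fun x => x ^ 2) (fun x => 2 * x)).
  - intro x. auto_derive; [auto|ring].
  - intro x. reg.
Qed.

End C1on_closure.

Lemma C1on_sub (V W : R -> R -> Prop) f ft fr :
  (forall t r, V t r -> W t r) -> C1on W f ft fr -> C1on V f ft fr.
Proof. intros HVW Hf t r H. apply Hf, HVW, H. Qed.

(** Continuity of a partial derivative upgrades partial to total differentiability; the chain rule
    for null coordinates needs the latter. *)
Lemma C1on_differentiable (W : R -> R -> Prop) f ft fr t r :
  open2 W -> C1on W f ft fr -> W t r ->
  differentiable_pt_lim f t r (ft t r) (fr t r).
Proof.
  intros HW Hf H. apply filterdiff_differentiable_pt_lim.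
  destruct (Hf t r H) as [F1 [F2 [F3 [F4 F5]]]].
  apply (is_derive_filterdiff f t r ft (fr t r)).
  - destruct (HW t r H) as [d [Hd Hball]].
    exists (mkposreal d Hd). intros [x y] [Hx Hy]. apply Hf, Hball; assumption.
  - exact F2.
  - apply continuity_2d_pt_filterlim. exact F4.
Qed.

Lemma cont2_comp_lin (f : R -> R -> R) (a b a' b' x y : R) :
  continuity_2d_pt f (a * x + b * y) (a' * x + b' * y) ->
  continuity_2d_pt (fun u v => f (a * u + b * v) (a' * u + b' * v)) x y.
Proof.
  intros Hf eps. destruct (Hf eps) as [d Hd].
  set (k := Rabs a + Rabs b + Rabs a' + Rabs b' + 1).
  assert (Ha := Rabs_pos a). assert (Hb := Rabs_pos b).
  assert (Ha' := Rabs_pos a'). assert (Hb' := Rabs_pos b').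
  assert (Hk : 0 < k) by (unfold k; lra).
  assert (Hdk : 0 < d / k) by (apply Rdiv_lt_0_compat; [apply cond_pos|exact Hk]).
  assert (Haux : forall p q u v, Rabs p + Rabs q < k ->
    Rabs (u - x) < d / k -> Rabs (v - y) < d / k ->
    Rabs (p * u + q * v - (p * x + q * y)) < d).
  { intros p q u v Hpq Hu Hv.
    replace (p * u + q * v - (p * x + q * y)) with (p * (u - x) + q * (v - y)) by ring.
    eapply Rle_lt_trans; [apply Rabs_triang|]. rewrite !Rabs_mult.
    assert (Hp := Rabs_pos p). assert (Hq := Rabs_pos q).
    apply Rle_lt_trans with ((Rabs p + Rabs q) * (d / k)); [nra|].
    replace (pos d) with (k * (d / k)) at 2 by (field; lra).
    apply Rmult_lt_compat_r; assumption. }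
  exists (mkposreal _ Hdk). simpl. intros u v Hu Hv.
  apply Hd; apply Haux; try assumption; unfold k; lra.
Qed.

Lemma C1on_comp_lin (W : R -> R -> Prop) f ft fr (a b a' b' : R) :
  open2 W -> C1on W f ft fr ->
  C1on (fun x y => W (a * x + b * y) (a' * x + b' * y))
    (fun x y => f (a * x + b * y) (a' * x + b' * y))
    (fun x y => ft (a * x + b * y) (a' * x + b' * y) * a
              + fr (a * x + b * y) (a' * x + b' * y) * a')
    (fun x y => ft (a * x + b * y) (a' * x + b' * y) * b
              + fr (a * x + b * y) (a' * x + b' * y) * b').
Proof.
  intros HW Hf x y H.
  assert (Hd := C1on_differentiable W f ft fr _ _ HW Hf H).
  destruct (Hf _ _ H) as [_ [_ [F3 [F4 F5]]]].
  split.
  { apply is_derive_Reals.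
    apply (derivable_pt_lim_comp_2d f (fun x => a * x + b * y) (fun x => a' * x + b' * y));
      [exact Hd| |]; apply is_derive_Reals; auto_derive; trivial; ring. }
  split.
  { apply is_derive_Reals.
    apply (derivable_pt_lim_comp_2d f (fun y => a * x + b * y) (fun y => a' * x + b' * y));
      [exact Hd| |]; apply is_derive_Reals; auto_derive; trivial; ring. }
  split; [apply cont2_comp_lin; exact F3|].
  split; apply continuity_2d_pt_plus; apply continuity_2d_pt_mult;
    try apply continuity_2d_pt_const;
    [apply (cont2_comp_lin ft)|apply (cont2_comp_lin fr)|
     apply (cont2_comp_lin ft)|apply (cont2_comp_lin fr)]; assumption.
Qed.

Lemma open2_comp_lin (W : R -> R -> Prop) (a b a' b' : R) :
  open2 W -> open2 (fun x y => W (a * x + b * y) (a' * x + b' * y)).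
Proof.
  intros HW x y H. destruct (HW _ _ H) as [d [Hd Hball]].
  assert (Hc : forall p q, continuity_2d_pt (fun u v => p * u + q * v) x y).
  { intros p q. apply (cont2_comp_lin (fun u _ => u) p q 0 0).
    apply continuity_2d_pt_id1. }
  destruct (Hc a b (mkposreal d Hd)) as [d1 H1].
  destruct (Hc a' b' (mkposreal d Hd)) as [d2 H2].
  exists (Rmin d1 d2). split; [apply Rmin_pos; apply cond_pos|].
  intros u v Hu Hv. assert (Hl := Rmin_l d1 d2). assert (Hr := Rmin_r d1 d2).
  apply Hball; [apply H1|apply H2]; lra.
Qed.

(** * Differentiation of integrals over slices *)

Lemma cont2_section (f : R -> R -> R) t r :
  continuity_2d_pt f t r -> continuous (fun x => f t x) r.
Proof.
  intros Hf. apply continuity_pt_filterlim. intros eps Heps.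
  destruct (Hf (mkposreal eps Heps)) as [d Hd].
  exists d. split; [apply cond_pos|]. intros x [_ Hx].
  apply Hd; [|exact Hx]. rewrite Rminus_diag, Rabs_R0. apply cond_pos.
Qed.

Lemma C1on_section_ex_RInt (W : R -> R -> Prop) f ft fr t a b :
  C1on W f ft fr -> a <= b -> (forall r, a <= r <= b -> W t r) ->
  ex_RInt (f t) a b.
Proof.
  intros Hf Hab H. apply (@ex_RInt_continuous R_CompleteNormedModule).
  intros z Hz. rewrite Rmin_left, Rmax_right in Hz by exact Hab.
  apply cont2_section, (Hf t z (H z Hz)).
Qed.

Lemma RInt_const_R (a b c : R) : RInt (fun _ => c) a b = (b - a) * c.
Proof. exact (RInt_const a b c). Qed.

(* The exact [r]-derivative [Br] contained in the source goes to the boundary. *)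
Lemma slice_derive (W : R -> R -> Prop) A At Ar B Bt Br (l h : R -> R) dl dh t :
  open2 W -> C1on W A At Ar -> C1on W B Bt Br ->
  is_derive l t dl -> is_derive h t dh -> l t <= h t ->
  (forall r, l t <= r <= h t -> W t r) ->
  is_derive (fun x => RInt (A x) (l x) (h x)) t
    (A t (h t) * dh - A t (l t) * dl + B t (h t) - B t (l t)
     + RInt (fun r => At t r - Br t r) (l t) (h t)).
Proof.
  intros HW HA HB Hl Hh Hlh Hseg.
  destruct (tube W t (l t) (h t) HW Hlh Hseg) as [d [Hd Htube]].
  set (e := d / 2). assert (He : 0 < e < d) by (unfold e; lra).
  assert (HDer : forall x y, W x y -> Derive (fun z => A z y) x = At x y).
  { intros x y H. apply is_derive_unique, (HA x y H). }
  assert (Hcont : forall x y, W x y ->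
    continuity_2d_pt (fun u v => Derive (fun z => A z v) u) x y).
  { intros x y H. apply continuity_2d_pt_ext_loc with At; [|apply (HA x y H)].
    destruct (HW x y H) as [d' [Hd' Hball]]. exists (mkposreal d' Hd').
    intros u v Hu Hv. symmetry. apply HDer, Hball; assumption. }
  assert (Hloc2 : forall y, W t y -> locally_2d (fun x' y' =>
    continuity_2d_pt (fun u v => Derive (fun z => A z v) u) x' y') t y).
  { intros y H. destruct (HW t y H) as [d' [Hd' Hball]]. exists (mkposreal d' Hd').
    intros u v Hu Hv. apply Hcont, Hball; assumption. }
  assert (HexA : forall x p q, Rabs (x - t) < d -> l t - d < p -> p <= q -> q < h t + d ->
    ex_RInt (fun y => A x y) p q).
  { intros x p q Hx Hp Hpq Hq. apply (C1on_section_ex_RInt W A At Ar); [exact HA|exact Hpq|].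
    intros r Hr. apply Htube; [exact Hx|lra]. }
  assert (Hlt : W t (l t)) by (apply Hseg; lra).
  assert (Hht : W t (h t)) by (apply Hseg; lra).
  evar_last.
  - apply (is_derive_RInt_param_bound_comp A l h t dl dh).
    + exists (mkposreal d Hd). intros x Hx. apply HexA; [exact Hx| | |]; lra.
    + exists (mkposreal e (proj1 He)). exists (mkposreal d Hd). intros x Hx.
      simpl. apply HexA; [exact Hx| | |]; lra.
    + exists (mkposreal e (proj1 He)). exists (mkposreal d Hd). intros x Hx.
      simpl. apply HexA; [exact Hx| | |]; lra.
    + exact Hl.
    + exact Hh.
    + exists (mkposreal e (proj1 He)). exists (mkposreal d Hd). intros x Hx y Hy.
      simpl in Hy. rewrite Rmin_left, Rmax_right in Hy by lra.
      exists (At x y). apply HA, Htube; [exact Hx|lra].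
    + intros y Hy. rewrite Rmin_left, Rmax_right in Hy by exact Hlh.
      apply Hcont, Hseg, Hy.
    + apply Hloc2, Hlt.
    + apply Hloc2, Hht.
    + apply continuity_pt_filterlim, cont2_section, (HA _ _ Hlt).
    + apply continuity_pt_filterlim, cont2_section, (HA _ _ Hht).
  - rewrite (RInt_ext _ (fun r => At t r)).
    2: { intros x Hx. rewrite Rmin_left, Rmax_right in Hx by exact Hlh.
         apply HDer, Hseg. lra. }
    assert (HexAt : ex_RInt (fun r => At t r) (l t) (h t)).
    { apply (@ex_RInt_continuous R_CompleteNormedModule). intros z Hz.
      rewrite Rmin_left, Rmax_right in Hz by exact Hlh.
      apply cont2_section, (HA _ _ (Hseg z Hz)). }
    assert (HBr : is_RInt (fun r => Br t r) (l t) (h t) (B t (h t) - B t (l t))).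
    { apply (@is_RInt_derive R_CompleteNormedModule (fun r => B t r));
        intros z Hz; rewrite Rmin_left, Rmax_right in Hz by exact Hlh.
      - apply (HB _ _ (Hseg z Hz)).
      - apply cont2_section, (HB _ _ (Hseg z Hz)). }
    assert (Hm : RInt (fun r => At t r - Br t r) (l t) (h t)
      = RInt (fun r => At t r) (l t) (h t) - (B t (h t) - B t (l t))).
    { rewrite <- (is_RInt_unique _ _ _ _ HBr).
      apply (@RInt_minus R_CompleteNormedModule); [exact HexAt|].
      eexists; exact HBr. }
    rewrite Hm. ring.
Qed.

Lemma nondecreasing_of_derive (f : R -> R) (a b : R) :
  a <= b ->
  (forall x, a <= x <= b -> exists d, is_derive f x d /\ 0 <= d) ->
  f a <= f b.
Proof.
  intros Hab H.
  assert (HD : forall x, a <= x <= b -> is_derive f x (Derive f x) /\ 0 <= Derive f x).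
  { intros x Hx. destruct (H x Hx) as [d [Hd Hp]].
    rewrite (is_derive_unique _ _ _ Hd). split; assumption. }
  destruct (MVT_gen f a b (Derive f)) as [c [Hc Heq]].
  - intros x Hx. rewrite Rmin_left, Rmax_right in Hx by exact Hab. apply HD. lra.
  - intros x Hx. rewrite Rmin_left, Rmax_right in Hx by exact Hab.
    apply derivable_continuous_pt. exists (Derive f x). apply is_derive_Reals, HD, Hx.
  - rewrite Rmin_left, Rmax_right in Hc by exact Hab.
    destruct (HD c Hc) as [_ Hp]. nra.
Qed.

Lemma exp_le_compat x y : x <= y -> exp x <= exp y.
Proof.
  intros [H | ->]; [apply Rlt_le, exp_increasing, H|apply Rle_refl].
Qed.

(** Fills in partial derivatives left as existential variables, following the syntax of the
    function. A quotient is treated as a product with an inverse; nonvanishing conditions and the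
    leaves [D i j] remain for the caller. *)
Ltac C1on_auto :=
  repeat first
  [ match goal with
    | |- C1on _ (fun t r => _ + _) _ _ => apply C1on_plus
    | |- C1on _ (fun t r => _ - _) _ _ => apply C1on_minus
    | |- C1on _ (fun t r => _ * _) _ _ => apply C1on_mult
    | |- C1on _ (fun t r => _ / _) _ _ => apply C1on_mult
    | |- C1on _ (fun t r => _ ^ 2) _ _ => apply C1on_sqr
    | |- C1on _ (fun t r => sin _) _ _ => apply C1on_sin
    | |- C1on _ (fun t r => exp _) _ _ => apply C1on_exp
    | |- C1on _ (fun t r => / _) _ _ => apply C1on_inv
    | |- C1on _ (fun t r => t) _ _ => apply C1on_fst
    | |- C1on _ (fun t r => r) _ _ => apply C1on_snd
    | |- C1on _ (fun t r => ?c) _ _ => apply (C1on_const _ c)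
    end
  | eassumption ].

(** * Balance laws and regularity at the axis *)

Section Skyrme.

Variables (alpha T0 : R) (D : nat -> nat -> R -> R -> R) (U : R -> R -> Prop).
Hypothesis alpha_pos : 0 < alpha.
Hypothesis U_open : open2 U.
Hypothesis Omega_U : forall t r, Omega T0 t r -> U t r.
Hypothesis D_smooth : smooth_family U D.
Hypothesis pde : forall t r, 0 < t <= T0 -> 0 < r <= t -> skyrme_eq alpha D t r.
Hypothesis axis : forall t, 0 < t <= T0 -> D 0%nat 0%nat t 0 = 0.

Local Notation u := (D 0%nat 0%nat).
Local Notation ut := (D 1%nat 0%nat).
Local Notation ur := (D 0%nat 1%nat).
Local Notation e := (energy_density alpha D).

Definition off_axis (t r : R) : Prop := U t r /\ 0 < r.

Lemma off_axis_open : open2 off_axis.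
Proof.
  apply open2_and; [exact U_open|]. intros t r Hr. exists r. split; [exact Hr|].
  intros t' r' _ H. apply Rabs_def2 in H. lra.
Qed.

Lemma cone_off_axis t r : 0 < t <= T0 -> 0 < r <= t -> off_axis t r.
Proof. intros Ht Hr. split; [apply Omega_U; unfold Omega; lra|lra]. Qed.

Lemma C1on_D i j : C1on U (D i j) (D (S i) j) (D i (S j)).
Proof.
  assert (Hc : forall k l t r, U t r -> continuity_2d_pt (D k l) t r).
  { intros k l t r H eps. destruct (D_smooth k l t r H) as [_ [_ Hc]].
    destruct (Hc eps (cond_pos eps)) as [d [Hd Hball]].
    exists (mkposreal d Hd). exact Hball. }
  intros t r H. destruct (D_smooth i j t r H) as [Ht [Hr _]].
  split; [apply is_derive_Reals; exact Ht|].
  split; [apply is_derive_Reals; exact Hr|].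
  repeat split; apply Hc; exact H.
Qed.

Lemma C1on_D_off_axis i j :
  C1on off_axis (fun t r => D i j t r) (D (S i) j) (D i (S j)).
Proof. apply (C1on_sub _ U); [intros t r [H _]; exact H|]. apply C1on_D. Qed.

(* [rF], [F] being the coefficient of [u_tt - u_rr] in the equation. *)
Definition rF (t r : R) : R := r + alpha ^ 2 * sin (u t r) ^ 2 / r.

(** Regularity is asked on the open set [off_axis], the identity only on the closed cone, where the
    equation is known. Slices ending on [r = t] can then be differentiated in both time
    directions. *)
Definition balance (A B C : R -> R -> R) : Prop :=
  exists At Ar Bt Br, C1on off_axis A At Ar /\ C1on off_axis B Bt Br /\
    forall t r, 0 < t <= T0 -> 0 < r <= t -> At t r - Br t r = C t r.

Lemma balance_slice A B C (l h : R -> R) dl dh t :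
  balance A B C -> is_derive l t dl -> is_derive h t dh ->
  0 < l t -> l t <= h t -> h t <= t -> t <= T0 ->
  ex_RInt (C t) (l t) (h t) /\
  is_derive (fun x => RInt (A x) (l x) (h x)) t
    (A t (h t) * dh - A t (l t) * dl + B t (h t) - B t (l t)
     + RInt (C t) (l t) (h t)).
Proof.
  intros (At & Ar & Bt & Br & HA & HB & HC) Hl Hh H1 H2 H3 H4.
  assert (Hseg : forall r, l t <= r <= h t -> off_axis t r).
  { intros r Hr. apply cone_off_axis; lra. }
  assert (Hext : forall r, Rmin (l t) (h t) < r < Rmax (l t) (h t) ->
    At t r - Br t r = C t r).
  { intros r Hr. rewrite Rmin_left, Rmax_right in Hr by exact H2.
    apply HC; lra. }
  split.
  - apply (ex_RInt_ext (fun r => At t r - Br t r)); [exact Hext|].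
    apply (@ex_RInt_continuous R_CompleteNormedModule). intros z Hz.
    rewrite Rmin_left, Rmax_right in Hz by exact H2. specialize (Hseg z Hz).
    apply (@continuous_minus R_UniformSpace R_AbsRing R_NormedModule);
      apply cont2_section; [apply (HA _ _ Hseg)|apply (HB _ _ Hseg)].
  - rewrite <- (RInt_ext _ _ _ _ Hext).
    apply (slice_derive off_axis _ _ Ar _ Bt _ l h);
      [exact off_axis_open|exact HA|exact HB|exact Hl|exact Hh|exact H2|exact Hseg].
Qed.

Ltac C1on_solve :=
  C1on_auto; try apply C1on_D_off_axis;
  try (intros ? ? [_ ?]; try apply pow_nonzero; lra).

Lemma C1on_rF : exists ft fr, C1on off_axis rF ft fr.
Proof. do 2 eexists. unfold rF. C1on_solve. Qed.

Lemma energy_balance : balance e (fun t r => rF t r * ut t r * ur t r) (fun _ _ => 0).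
Proof.
  do 4 eexists. split; [unfold energy_density; C1on_solve|].
  { intros x y [_ H]. nra. }
  split; [unfold rF; C1on_solve|].
  intros t r Ht Hr. cbv beta.
  assert (HP := pde t r Ht Hr). unfold skyrme_eq in HP. cbv zeta in HP.
  rewrite sin_2a in HP.
  (* Energy conservation comes from the multiplier [r u_t]. *)
  match type of HP with ?x = 0 => transitivity (r * ut t r * x) end.
  - field. lra.
  - rewrite HP. ring.
Qed.

Definition morawetz (t r : R) : R :=
  -9 * (r * rF t r * ut t r * ur t r)
  - 4 * (r * sin (u t r) * ut t r) + rF t r * ut t r * sin (u t r).

Definition morawetz_flux (t r : R) : R :=
  -9 * (r * rF t r * (ut t r ^ 2 + ur t r ^ 2) / 2 - sin (u t r) ^ 2 / 2)
  - 4 * (r * sin (u t r) * ur t r) + rF t r * ur t r * sin (u t r).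

Definition morawetz_source (t r : R) : R :=
  9 * (r * ut t r ^ 2 + alpha ^ 2 * sin (u t r) ^ 2 / r * ur t r ^ 2)
  - 4 * ((r * cos (u t r) * (ut t r ^ 2 - ur t r ^ 2)
          - sin (u t r) ^ 2 * cos (u t r) / r) * r / rF t r
         - 2 * (alpha ^ 2 * sin (u t r) ^ 2 / r) * sin (u t r) * ur t r / rF t r)
  + cos (u t r) * (ut t r ^ 2 - ur t r ^ 2)
    * (r + 2 * (alpha ^ 2 * sin (u t r) ^ 2 / r))
  - sin (u t r) ^ 2 * cos (u t r) / r.

(* The multiplier is [-9 r u_r - 4 sin u / F + sin u]: the first term gives a
   virial identity whose source [r u_t^2 + alpha^2 sin^2 u u_r^2 / r] has a sign,
   the second then controls [r u_r^2] and the third [alpha^2 sin^2 u u_t^2 / r]. *)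
Lemma morawetz_balance : balance morawetz morawetz_flux morawetz_source.
Proof.
  do 4 eexists. split; [unfold morawetz, rF; C1on_solve|].
  split; [unfold morawetz_flux, rF; C1on_solve|].
  intros t r Ht Hr. cbv beta.
  assert (HP := pde t r Ht Hr). unfold skyrme_eq in HP. cbv zeta in HP.
  rewrite sin_2a in HP. unfold morawetz_source, rF.
  assert (Hs := pow2_ge_0 (alpha * sin (u t r))).
  apply Rminus_diag_uniq.
  match type of HP with ?x = 0 =>
    transitivity (((-9 * r * ur t r + sin (u t r)) * r
      - 4 * sin (u t r) * r / (1 + alpha ^ 2 * sin (u t r) ^ 2 / r ^ 2)) * x) end.
  2: { rewrite HP. ring. }
  assert (Hn1 : r * r + alpha ^ 2 * sin (u t r) ^ 2 <> 0) by nra.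
  field. repeat split; try lra; try nra.
Qed.


(** * Bounds and continuity at the axis *)

Lemma energy_density_split t r : 0 < r ->
  e t r = rF t r * (ut t r ^ 2 + ur t r ^ 2) / 2 + sin (u t r) ^ 2 / (2 * r).
Proof. intro Hr. unfold energy_density, rF. field. lra. Qed.

Lemma rF_ge t r : 0 < r -> r <= rF t r.
Proof.
  intro Hr. unfold rF.
  assert (0 <= alpha ^ 2 * sin (u t r) ^ 2 / r); [|lra].
  apply Rmult_le_pos; [nra|apply Rlt_le, Rinv_0_lt_compat, Hr].
Qed.

Lemma sin_sqr_div_ge0 t r : 0 < r -> 0 <= sin (u t r) ^ 2 / (2 * r).
Proof.
  intro Hr. apply Rmult_le_pos; [nra|apply Rlt_le, Rinv_0_lt_compat; lra].
Qed.

Lemma energy_density_ge0 t r : 0 < r -> 0 <= e t r.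
Proof.
  intro Hr. rewrite energy_density_split by exact Hr.
  assert (H1 := rF_ge t r Hr). assert (H2 := sin_sqr_div_ge0 t r Hr).
  assert (0 <= rF t r * (ut t r ^ 2 + ur t r ^ 2)); [|lra].
  apply Rmult_le_pos; [lra|nra].
Qed.

Lemma sin_sqr_le_sqr x : sin x ^ 2 <= x ^ 2.
Proof.
  assert (Hp : forall y, 0 <= y -> sin y ^ 2 <= y ^ 2).
  { intros y Hy. destruct (Req_dec y 0) as [->|Hn]; [rewrite sin_0; lra|].
    assert (H1 : sin y < y) by (apply sin_lt_x; lra).
    destruct (Rle_dec y 1).
    - assert (0 <= sin y) by (apply sin_ge_0; [lra|assert (H := PI2_1); lra]). nra.
    - assert (H := SIN_bound y). nra. }
  destruct (Rle_dec 0 x) as [H|H]; [apply Hp, H|].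
  replace (sin x ^ 2) with (sin (- x) ^ 2) by (rewrite sin_neg; ring).
  replace (x ^ 2) with ((- x) ^ 2) by ring. apply Hp. lra.
Qed.

(** The rectangle [r <= a <= t] lies in the cone, so derivatives are bounded on it; the mean value
    theorem from [u = 0] on the axis gives the linear bound. *)
Lemma axis_bound a b : 0 < a -> a <= b -> b <= T0 ->
  exists L, 0 < L /\ forall t r, a <= t <= b -> 0 <= r <= a ->
    Rabs (ut t r) <= L /\ Rabs (ur t r) <= L /\ Rabs (u t r) <= L * r.
Proof.
  intros Ha Hab Hb.
  assert (HU : forall t r, a <= t <= b -> 0 <= r <= a -> U t r).
  { intros t r Ht Hr. apply Omega_U. unfold Omega. lra. }
  assert (Hbd : forall i j, exists M, 0 < M /\
    forall t r, a <= t <= b -> 0 <= r <= a -> Rabs (D i j t r) <= M).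
  { intros i j. apply bounded_on_rectangle; [exact Hab|lra|].
    intros t r Ht Hr. apply (C1on_D i j t r (HU t r Ht Hr)). }
  destruct (Hbd 1%nat 0%nat) as [M1 [HM1 H1]].
  destruct (Hbd 0%nat 1%nat) as [M2 [HM2 H2]].
  exists (M1 + M2). split; [lra|]. intros t r Ht Hr.
  specialize (H1 t r Ht Hr). split; [lra|].
  split; [specialize (H2 t r Ht Hr); lra|].
  destruct (MVT_gen (fun x => u t x) 0 r (fun x => ur t x)) as [c [Hc Heq]].
  - intros x Hx. rewrite Rmin_left, Rmax_right in Hx by lra.
    apply (C1on_D 0 0). apply HU; lra.
  - intros x Hx. rewrite Rmin_left, Rmax_right in Hx by lra.
    apply continuity_pt_filterlim, cont2_section, (C1on_D 0 0). apply HU; lra.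
  - rewrite Rmin_left, Rmax_right in Hc by lra.
    rewrite axis in Heq by lra.
    replace (u t r) with (ur t c * r) by lra.
    rewrite Rabs_mult, (Rabs_pos_eq r) by lra.
    apply Rmult_le_compat_r; [lra|]. specialize (H2 t c Ht). lra.
Qed.

(** From [sin^2 u <= L^2 r^2] follows [rF <= k r], so the singular quotients are harmless. These are
    exactly the terms left behind at a cut [r = eps]. *)
Lemma axis_terms a b : 0 < a -> a <= b -> b <= T0 ->
  exists C, 0 < C /\ forall t r, a <= t <= b -> 0 < r <= a ->
    e t r <= C * r /\
    Rabs (rF t r * ut t r * ur t r) <= C * r /\
    Rabs (morawetz_flux t r) <= C * r.
Proof.
  intros Ha Hab Hb. destruct (axis_bound a b Ha Hab Hb) as [L [HL Hbd]].
  set (k := 1 + alpha ^ 2 * L ^ 2).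
  assert (Hk : 1 <= k) by (unfold k; nra).
  exists ((9 * k + 15) * L ^ 2 * (1 + a) + k * L ^ 2 * (1 + a)).
  split.
  { assert (0 < L ^ 2) by nra. assert (0 < L ^ 2 * (1 + a)) by nra.
    replace ((9 * k + 15) * L ^ 2 * (1 + a) + k * L ^ 2 * (1 + a))
      with ((10 * k + 15) * (L ^ 2 * (1 + a))) by ring. nra. }
  intros t r Ht Hr. destruct (Hbd t r Ht) as [H1 [H2 H3]]; [lra|].
  assert (Hs : sin (u t r) ^ 2 <= (L * r) ^ 2).
  { eapply Rle_trans; [apply sin_sqr_le_sqr|]. rewrite <- (pow2_abs (u t r)).
    assert (H := Rabs_pos (u t r)). nra. }
  assert (Hs1 : Rabs (sin (u t r)) <= L * r).
  { assert (H := Rabs_pos (sin (u t r))). rewrite <- (pow2_abs (sin _)) in Hs.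
    assert (0 <= L * r) by nra.
    destruct (Rle_dec (Rabs (sin (u t r))) (L * r)); [assumption|nra]. }
  assert (HF0 := rF_ge t r (proj1 Hr)).
  assert (HF : rF t r <= k * r).
  { unfold rF, k. apply Rplus_le_reg_l with (- r).
    apply Rmult_le_reg_r with r; [lra|]. unfold Rdiv.
    replace ((- r + (r + alpha ^ 2 * sin (u t r) ^ 2 * / r)) * r)
      with (alpha ^ 2 * sin (u t r) ^ 2) by (field; lra).
    assert (0 < alpha ^ 2) by nra. nra. }
  assert (Ht2 : ut t r ^ 2 <= L ^ 2).
  { rewrite <- pow2_abs. assert (H := Rabs_pos (ut t r)). nra. }
  assert (Hr2 : ur t r ^ 2 <= L ^ 2).
  { rewrite <- pow2_abs. assert (H := Rabs_pos (ur t r)). nra. }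
  assert (HL2 : 0 < L ^ 2) by nra.
  assert (HrF : rF t r * (ut t r ^ 2 + ur t r ^ 2) / 2 <= k * r * L ^ 2).
  { assert (0 <= ut t r ^ 2) by nra. assert (0 <= ur t r ^ 2) by nra.
    assert (rF t r * (ut t r ^ 2 + ur t r ^ 2) <= (k * r) * (L ^ 2 + L ^ 2));
      [apply Rmult_le_compat; lra|lra]. }
  assert (HrF0 : 0 <= rF t r * (ut t r ^ 2 + ur t r ^ 2) / 2).
  { assert (0 <= rF t r * (ut t r ^ 2 + ur t r ^ 2)); [apply Rmult_le_pos; nra|lra]. }
  assert (Hsr : sin (u t r) ^ 2 / (2 * r) <= L ^ 2 * r).
  { apply Rmult_le_reg_r with (2 * r); [lra|].
    replace (sin (u t r) ^ 2 / (2 * r) * (2 * r)) with (sin (u t r) ^ 2) by (field; lra).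
    nra. }
  set (X := k * L ^ 2 * r). set (Y := L ^ 2 * r).
  assert (HX : 0 <= X) by (unfold X; apply Rmult_le_pos; nra).
  assert (HY : 0 <= Y) by (unfold Y; nra).
  assert (HXa : 0 <= X * a) by (apply Rmult_le_pos; lra).
  assert (HYa : 0 <= Y * a) by (apply Rmult_le_pos; lra).
  replace (((9 * k + 15) * L ^ 2 * (1 + a) + k * L ^ 2 * (1 + a)) * r)
    with (10 * X + 15 * Y + 10 * (X * a) + 15 * (Y * a)) by (unfold X, Y; ring).
  split; [|split].
  - rewrite energy_density_split by lra. unfold X, Y in *. lra.
  - rewrite !Rabs_mult, (Rabs_pos_eq (rF t r)) by lra.
    apply Rle_trans with X; [|lra]. unfold X.
    replace (k * L ^ 2 * r) with (k * r * L * L) by ring.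
    assert (A1 := Rabs_pos (ut t r)). assert (A2 := Rabs_pos (ur t r)).
    apply Rmult_le_compat; [apply Rmult_le_pos; lra|lra| |lra].
    apply Rmult_le_compat; lra.
  - unfold morawetz_flux. set (g := rF t r * (ut t r ^ 2 + ur t r ^ 2) / 2) in *.
    replace (r * rF t r * (ut t r ^ 2 + ur t r ^ 2) / 2) with (r * g)
      by (unfold g; field).
    assert (G1 : 0 <= r * g <= X * a).
    { split; [apply Rmult_le_pos; lra|]. unfold X.
      replace (k * L ^ 2 * r * a) with (a * (k * r * L ^ 2)) by ring.
      apply Rmult_le_compat; lra. }
    assert (G2 : 0 <= sin (u t r) ^ 2 <= Y * a).
    { split; [nra|]. unfold Y. eapply Rle_trans; [exact Hs|].
      replace ((L * r) ^ 2) with (L ^ 2 * r * r) by ring.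
      apply Rmult_le_compat_l; [nra|lra]. }
    assert (A2 := Rabs_pos (ur t r)). assert (A3 := Rabs_pos (sin (u t r))).
    assert (G0 : Rabs (ur t r) * Rabs (sin (u t r)) <= L * (L * r))
      by (apply Rmult_le_compat; lra).
    assert (G00 : 0 <= Rabs (ur t r) * Rabs (sin (u t r))) by (apply Rmult_le_pos; lra).
    assert (G3 : Rabs (r * sin (u t r) * ur t r) <= Y * a).
    { rewrite !Rabs_mult, (Rabs_pos_eq r) by lra. unfold Y.
      replace (L ^ 2 * r * a) with (a * (L * (L * r))) by ring.
      replace (r * Rabs (sin (u t r)) * Rabs (ur t r))
        with (r * (Rabs (ur t r) * Rabs (sin (u t r)))) by ring.
      apply Rmult_le_compat; lra. }
    assert (G4 : Rabs (rF t r * ur t r * sin (u t r)) <= X * a).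
    { rewrite !Rabs_mult, (Rabs_pos_eq (rF t r)) by lra. unfold X.
      apply Rle_trans with (k * r * (L * (L * r))).
      - rewrite Rmult_assoc. apply Rmult_le_compat; lra.
      - replace (k * r * (L * (L * r))) with (k * L ^ 2 * r * r) by ring.
        apply Rmult_le_compat_l; [exact HX|lra]. }
    apply Rabs_le_between in G3. apply Rabs_le_between in G4.
    apply Rabs_le. lra.
Qed.

(** At the axis the limit is two-sided, so negative [r] occurs as well. The bound on [u / r]
    therefore comes from the difference quotient at [r = 0], not from the estimates inside the
    cone. *)
Lemma energy_density_continuous t r : 0 < t <= T0 -> 0 <= r <= t ->
  continuous (e t) r.
Proof.
  intros Ht Hr.
  destruct (Req_dec r 0) as [->|Hr0].
  2: { destruct energy_balance as (At & Ar & _ & _ & HA & _).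
       apply cont2_section, (HA t r). apply cone_off_axis; lra. }
  assert (HU : U t 0) by (apply Omega_U; unfold Omega; lra).
  destruct (C1on_D 0 0 t 0 HU) as [_ [Hder _]].
  apply is_derive_Reals in Hder.
  destruct (Hder 1 Rlt_0_1) as [d1 Hd1].
  assert (Hc : forall i j, exists d, 0 < d /\ forall x, Rabs x < d ->
    Rabs (D i j t x) <= Rabs (D i j t 0) + 1).
  { intros i j. destruct (C1on_D i j t 0 HU) as [_ [_ [Hc _]]].
    destruct (Hc (mkposreal 1 Rlt_0_1)) as [d Hd].
    exists d. split; [apply cond_pos|]. intros x Hx.
    replace (D i j t x) with (D i j t 0 + (D i j t x - D i j t 0)) by ring.
    eapply Rle_trans; [apply Rabs_triang|]. apply Rplus_le_compat_l, Rlt_le, Hd.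
    - rewrite Rminus_diag, Rabs_R0. apply cond_pos.
    - rewrite Rminus_0_r. exact Hx. }
  destruct (Hc 1%nat 0%nat) as [d2 [Hd2 H2]].
  destruct (Hc 0%nat 1%nat) as [d3 [Hd3 H3]].
  set (L := Rabs (ut t 0) + Rabs (ur t 0) + 1).
  assert (P1 := Rabs_pos (ut t 0)). assert (P2 := Rabs_pos (ur t 0)).
  assert (HL : 1 <= L) by (unfold L; lra).
  set (k := (1 + alpha ^ 2 * L ^ 2) * L ^ 2 + L ^ 2).
  assert (Hk : 0 < k) by (unfold k; nra).
  assert (Hbound : forall x, x <> 0 -> Rabs x < d1 -> Rabs x < d2 -> Rabs x < d3 ->
    Rabs (e t x) <= k * Rabs x).
  { intros x Hx X1 X2 X3.
    specialize (H2 x X2). specialize (H3 x X3). specialize (Hd1 x Hx X1).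
    rewrite Rplus_0_l, axis, Rminus_0_r in Hd1 by lra.
    assert (Hu : (u t x / x) ^ 2 <= L ^ 2).
    { rewrite <- pow2_abs. assert (Hq := Rabs_pos (u t x / x)).
      assert (Rabs (u t x / x) <= L); [|nra].
      replace (u t x / x) with (ur t 0 + (u t x / x - ur t 0)) by ring.
      eapply Rle_trans; [apply Rabs_triang|]. unfold L. lra. }
    assert (Hs : 0 <= sin (u t x) ^ 2 / x ^ 2 <= L ^ 2).
    { assert (Hx2 : 0 < x ^ 2) by nra.
      split; [apply Rmult_le_pos; [nra|apply Rlt_le, Rinv_0_lt_compat, Hx2]|].
      eapply Rle_trans; [|exact Hu].
      replace ((u t x / x) ^ 2) with (u t x ^ 2 / x ^ 2) by (field; exact Hx).
      apply Rmult_le_compat_r; [apply Rlt_le, Rinv_0_lt_compat, Hx2|].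
      apply sin_sqr_le_sqr. }
    assert (Ht2 : 0 <= ut t x ^ 2 <= L ^ 2).
    { split; [nra|]. rewrite <- pow2_abs. assert (Hq := Rabs_pos (ut t x)).
      unfold L. nra. }
    assert (Hr2 : 0 <= ur t x ^ 2 <= L ^ 2).
    { split; [nra|]. rewrite <- pow2_abs. assert (Hq := Rabs_pos (ur t x)).
      unfold L. nra. }
    unfold energy_density. rewrite Rabs_mult.
    apply Rmult_le_compat_r; [apply Rabs_pos|].
    set (S := sin (u t x) ^ 2 / x ^ 2) in *.
    replace (alpha ^ 2 * sin (u t x) ^ 2 / x ^ 2) with (alpha ^ 2 * S)
      by (unfold S; field; exact Hx).
    replace (sin (u t x) ^ 2 / (2 * x ^ 2)) with (S / 2) by (unfold S; field; exact Hx).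
    assert (Ha2 : 0 < alpha ^ 2) by nra.
    assert (B1 : 0 <= alpha ^ 2 * S <= alpha ^ 2 * L ^ 2)
      by (split; [nra|apply Rmult_le_compat_l; lra]).
    assert (B2 : (1 + alpha ^ 2 * S) * ((ut t x ^ 2 + ur t x ^ 2) / 2)
      <= (1 + alpha ^ 2 * L ^ 2) * L ^ 2) by (apply Rmult_le_compat; lra).
    assert (B3 : 0 <= (1 + alpha ^ 2 * S) * ((ut t x ^ 2 + ur t x ^ 2) / 2))
      by (apply Rmult_le_pos; lra).
    rewrite Rabs_pos_eq by lra. unfold k. lra. }
  apply continuity_pt_filterlim. intros eps Heps.
  exists (Rmin (Rmin d1 (Rmin d2 d3)) (eps / k)).
  split.
  { repeat apply Rmin_pos; try assumption; [apply cond_pos|].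
    apply Rdiv_lt_0_compat; assumption. }
  intros x [[_ Hx] Hdist]. simpl in *. unfold R_dist in *.
  rewrite Rminus_0_r in Hdist.
  assert (M1 := Rmin_l (Rmin d1 (Rmin d2 d3)) (eps / k)).
  assert (M2 := Rmin_r (Rmin d1 (Rmin d2 d3)) (eps / k)).
  assert (M3 := Rmin_l d1 (Rmin d2 d3)). assert (M4 := Rmin_r d1 (Rmin d2 d3)).
  assert (M5 := Rmin_l d2 d3). assert (M6 := Rmin_r d2 d3).
  (* The last factor [r] of the density is [0] here, so the value given to division by zero does not
     matter. *)
  replace (e t 0) with 0 by (unfold energy_density; ring).
  rewrite Rminus_0_r.
  eapply Rle_lt_trans; [apply Hbound; [auto|lra|lra|lra]|].
  apply Rlt_le_trans with (k * (eps / k)); [apply Rmult_lt_compat_l; lra|].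
  right. field. lra.
Qed.

Lemma energy_density_ex_RInt t a b : 0 < t <= T0 -> 0 <= a -> a <= b -> b <= t ->
  ex_RInt (e t) a b.
Proof.
  intros Ht Ha Hab Hb. apply (@ex_RInt_continuous R_CompleteNormedModule).
  intros z Hz. rewrite Rmin_left, Rmax_right in Hz by exact Hab.
  apply energy_density_continuous; lra.
Qed.

(** * Energy conservation on the cone *)

Definition E (t : R) : R := RInt (e t) 0 t.

(** This is the density [e] plus the current [rF u_t u_r] at [r = t]: the moving endpoint
    contributes the first, the balance law the second. The sum is a perfect square plus the
    potential term, hence nonnegative. *)
Definition cone_flux (t : R) : R :=
  rF t t * (ut t t + ur t t) ^ 2 / 2 + sin (u t t) ^ 2 / (2 * t).

Lemma cone_flux_continuous t : 0 < t <= T0 -> continuous cone_flux t.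
Proof.
  intro Ht. assert (Ht2 : off_axis t t) by (apply cone_off_axis; lra).
  assert (HC : exists ft fr, C1on off_axis (fun t r =>
    rF t r * (ut t r + ur t r) ^ 2 / 2 + sin (u t r) ^ 2 / (2 * r)) ft fr).
  { destruct C1on_rF as (Ft & Fr & HF). do 2 eexists. C1on_solve. }
  destruct HC as (ft & fr & HC).
  (* Restriction to the diagonal, written as the linear change of variables [(x, y) -> (x, x)]. *)
  assert (Hl := C1on_comp_lin off_axis _ _ _ 1 0 1 0 off_axis_open HC).
  destruct (Hl t 0) as [Hd _].
  { replace (1 * t + 0 * 0) with t by ring. exact Ht2. }
  apply (@ex_derive_continuous R_AbsRing R_NormedModule). eexists.
  eapply is_derive_ext; [|exact Hd].
  intro x. cbv beta.
  assert (Hx : forall y : R, 1 * y + 0 * 0 = y) by (intro; ring).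
  rewrite Hx. reflexivity.
Qed.

Lemma cone_flux_ge t : 0 < t ->
  0 <= rF t t * (ut t t + ur t t) ^ 2 / 2 <= cone_flux t.
Proof.
  intro Ht. unfold cone_flux. assert (H1 := rF_ge t t Ht).
  assert (H2 := sin_sqr_div_ge0 t t Ht).
  assert (0 <= rF t t * (ut t t + ur t t) ^ 2); [|lra].
  apply Rmult_le_pos; [lra|apply pow2_ge_0].
Qed.

Lemma energy_near_axis a b : 0 < a -> a <= b -> b <= T0 ->
  exists C, 0 < C /\ forall t eps, a <= t <= b -> 0 < eps <= a ->
    0 <= E t - RInt (e t) eps t <= C * eps.
Proof.
  intros Ha Hab Hb. destruct (axis_terms a b Ha Hab Hb) as [C [HC H]].
  exists (C * a). split; [nra|]. intros t eps Ht Heps.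
  assert (He : ex_RInt (e t) 0 eps) by (apply energy_density_ex_RInt; lra).
  assert (Hsplit : E t = RInt (e t) 0 eps + RInt (e t) eps t).
  { unfold E. symmetry.
    apply (@RInt_Chasles R_CompleteNormedModule); [exact He|].
    apply energy_density_ex_RInt; lra. }
  enough (0 <= RInt (e t) 0 eps <= C * a * eps) by lra.
  split.
  - apply RInt_ge_0; [lra|exact He|]. intros x Hx. apply energy_density_ge0. lra.
  - apply Rle_trans with (RInt (fun _ => C * a) 0 eps).
    2: { rewrite RInt_const_R. lra. }
    apply RInt_le; [lra|exact He|apply ex_RInt_const|].
    intros x Hx. destruct (H t x Ht) as [H1 _]; [lra|].
    eapply Rle_trans; [exact H1|]. apply Rmult_le_compat_l; lra.
Qed.

Lemma truncated_energy_derive t eps : 0 < eps <= t -> t <= T0 ->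
  is_derive (fun x => RInt (e x) eps x) t
    (cone_flux t - rF t eps * ut t eps * ur t eps).
Proof.
  intros Heps Ht.
  destruct (balance_slice _ _ _ (fun _ => eps) (fun x => x) 0 1 t energy_balance)
    as [_ H]; try lra.
  - apply (@is_derive_const R_AbsRing).
  - apply (@is_derive_id R_AbsRing).
  - evar_last; [exact H|]. cbv beta.
    rewrite RInt_const_R, energy_density_split by lra.
    unfold cone_flux. field. lra.
Qed.

Lemma eq_of_linear_bound (x y c d : R) : 0 < d ->
  (forall eps, 0 < eps <= d -> Rabs (x - y) <= c * eps) -> x = y.
Proof.
  intros Hd H. apply Rminus_diag_uniq.
  destruct (Req_dec (x - y) 0) as [?|Hn]; [assumption|]. exfalso.
  assert (Hp := Rabs_pos_lt _ Hn). set (z := Rabs (x - y)) in *.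
  assert (Hc : 0 < c) by (specialize (H d); nra).
  assert (Hz : 0 < z / (2 * c)) by (apply Rdiv_lt_0_compat; lra).
  assert (Hm : 0 < Rmin d (z / (2 * c))) by (apply Rmin_pos; assumption).
  specialize (H (Rmin d (z / (2 * c)))).
  assert (M1 := Rmin_l d (z / (2 * c))). assert (M2 := Rmin_r d (z / (2 * c))).
  assert (c * Rmin d (z / (2 * c)) <= c * (z / (2 * c)))
    by (apply Rmult_le_compat_l; lra).
  replace (c * (z / (2 * c))) with (z / 2) in * by (field; lra). lra.
Qed.

(** The energy cut at [eps] has derivative [cone_flux] up to the current at [eps]. The cut and that
    current both cost [O(eps)] uniformly on the window, so the integrated identity survives
    [eps -> 0]. *)
Lemma energy_flux_identity a b s t : 0 < a -> b <= T0 -> a < s -> s <= t -> t < b ->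
  E t - E s = RInt cone_flux a t - RInt cone_flux a s.
Proof.
  intros Ha Hb Has Hst Htb.
  assert (Hab : a <= b) by lra.
  destruct (axis_terms a b Ha Hab Hb) as [C [HC Hax]].
  destruct (energy_near_axis a b Ha Hab Hb) as [C' [HC' Hnear]].
  apply (eq_of_linear_bound _ _ (C * (t - s) + 2 * C') a Ha).
  intros eps Heps.
  set (f := fun x => RInt (e x) eps x - RInt cone_flux a x).
  assert (Hf : forall x, s <= x <= t ->
    is_derive f x (- (rF x eps * ut x eps * ur x eps))).
  { intros x Hx. unfold f. evar_last.
    - apply (@is_derive_minus R_AbsRing).
      + apply truncated_energy_derive; lra.
      + apply (is_derive_RInt cone_flux _ a).
        * assert (Hd : 0 < Rmin (x - a) (b - x)) by (apply Rmin_pos; lra).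
          exists (mkposreal _ Hd). intros y Hy.
          change (Rabs (y - x) < Rmin (x - a) (b - x)) in Hy.
          assert (M1 := Rmin_l (x - a) (b - x)). assert (M2 := Rmin_r (x - a) (b - x)).
          apply Rabs_def2 in Hy.
          apply (@RInt_correct R_CompleteNormedModule).
          apply (@ex_RInt_continuous R_CompleteNormedModule). intros z Hz.
          rewrite Rmin_left, Rmax_right in Hz by lra.
          apply cone_flux_continuous. lra.
        * apply cone_flux_continuous. lra.
    - unfold minus, plus, opp; simpl. ring. }
  destruct (MVT_gen f s t (fun x => - (rF x eps * ut x eps * ur x eps)))
    as [c [Hc Heq]].
  - intros x Hx. rewrite Rmin_left, Rmax_right in Hx by lra. apply Hf. lra.
  - intros x Hx. rewrite Rmin_left, Rmax_right in Hx by lra.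
    apply derivable_continuous_pt. eexists. apply is_derive_Reals, Hf. lra.
  - rewrite Rmin_left, Rmax_right in Hc by lra. unfold f in Heq.
    destruct (Hax c eps) as [_ [H2 _]]; [lra|lra|].
    assert (N1 := Hnear t eps). assert (N2 := Hnear s eps).
    assert (H3 : Rabs (- (rF c eps * ut c eps * ur c eps) * (t - s))
      <= C * eps * (t - s)).
    { rewrite Rabs_mult, Rabs_Ropp, (Rabs_pos_eq (t - s)) by lra.
      apply Rmult_le_compat_r; lra. }
    apply Rabs_le_between in H3.
    replace ((C * (t - s) + 2 * C') * eps)
      with (C * eps * (t - s) + C' * eps + C' * eps) by ring.
    apply Rabs_le. lra.
Qed.

(** Near [t], [E] is a constant plus a primitive of the continuous [cone_flux]. The derivative is
    two-sided, whence [t < T0]. *)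
Lemma energy_derive t : 0 < t < T0 -> is_derive E t (cone_flux t).
Proof.
  intro Ht. set (a := t / 2). set (b := (t + T0) / 2).
  assert (Hd : 0 < Rmin (t - a) (b - t)) by (apply Rmin_pos; unfold a, b; lra).
  assert (M1 := Rmin_l (t - a) (b - t)). assert (M2 := Rmin_r (t - a) (b - t)).
  apply (is_derive_ext_loc (fun x => RInt cone_flux a x - RInt cone_flux a t + E t)).
  { exists (mkposreal _ Hd). intros y Hy.
    change (Rabs (y - t) < Rmin (t - a) (b - t)) in Hy. apply Rabs_def2 in Hy.
    destruct (Rle_dec t y).
    - assert (H := energy_flux_identity a b t y). unfold a, b in *. lra.
    - assert (H := energy_flux_identity a b y t). unfold a, b in *. lra. }
  evar_last.
  - apply (@is_derive_plus R_AbsRing); [|apply (@is_derive_const R_AbsRing)].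
    apply (@is_derive_minus R_AbsRing); [|apply (@is_derive_const R_AbsRing)].
    apply (is_derive_RInt cone_flux _ a).
    + exists (mkposreal _ Hd). intros y Hy.
      change (Rabs (y - t) < Rmin (t - a) (b - t)) in Hy. apply Rabs_def2 in Hy.
      apply (@RInt_correct R_CompleteNormedModule).
      apply (@ex_RInt_continuous R_CompleteNormedModule). intros z Hz.
      rewrite Rmin_left, Rmax_right in Hz by lra.
      apply cone_flux_continuous. unfold a, b in *. lra.
    + apply cone_flux_continuous. lra.
  - unfold minus, plus, opp, zero; simpl. ring.
Qed.

Lemma energy_mono s t : 0 < s -> s <= t -> t < T0 -> E s <= E t.
Proof.
  intros Hs Hst Ht. apply (nondecreasing_of_derive E); [exact Hst|].
  intros x Hx. exists (cone_flux x). split; [apply energy_derive; lra|].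
  assert (H := cone_flux_ge x). lra.
Qed.

Lemma energy_ge0 t : 0 < t <= T0 -> 0 <= E t.
Proof.
  intro Ht. unfold E. apply RInt_ge_0; [lra|apply energy_density_ex_RInt; lra|].
  intros x Hx. apply energy_density_ge0. lra.
Qed.

(** A monotone function bounded below is Cauchy at [0]. Since [E' = cone_flux], this is the
    smallness of the flux in the form in which it is used. *)
Lemma energy_oscillation eps : 0 < T0 -> 0 < eps ->
  exists d, 0 < d <= T0 / 2 /\ forall s t, 0 < s -> s <= t -> t <= d ->
    E t - E s <= eps.
Proof.
  intros HT0 Heps.
  destruct (completeness (fun x => exists t, 0 < t <= T0 / 2 /\ x = - E t))
    as [m [Hub Hlub]].
  - exists 0. intros x [t [Ht ->]]. assert (H := energy_ge0 t). lra.
  - exists (- E (T0 / 2)), (T0 / 2). lra.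
  - assert (Hex : exists t, 0 < t <= T0 / 2 /\ m - eps < - E t).
    { apply NNPP. intro Hn. assert (m <= m - eps); [|lra].
      apply Hlub. intros x [t [Ht ->]].
      destruct (Rle_dec (- E t) (m - eps)); [assumption|].
      exfalso. apply Hn. exists t. lra. }
    destruct Hex as [d [Hd Hm]]. exists d. split; [exact Hd|].
    intros s t Hs Hst Ht.
    assert (H1 : - E s <= m) by (apply Hub; exists s; lra).
    assert (H2 := energy_mono t d). lra.
Qed.

(** * Pointwise smallness of [u] near the tip *)

Definition K : R := E (T0 / 2) / alpha ^ 2 + / 4.

Lemma K_pos : 0 < T0 -> 0 < K.
Proof.
  intro HT0. unfold K. assert (H := energy_ge0 (T0 / 2)).
  assert (0 <= E (T0 / 2) / alpha ^ 2); [|lra].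
  apply Rmult_le_pos; [lra|]. apply Rlt_le, Rinv_0_lt_compat. nra.
Qed.

(* The Skyrme part [alpha^2 sin^2 u u_r^2 / r] of the energy controls the
   derivative [sin u u_r] of [1 - cos u]; this pointwise smallness is what
   separates the model from wave maps, for which energy can concentrate. *)
Lemma one_minus_cos_le t r : 0 < t <= T0 / 2 -> 0 < r <= t ->
  1 - cos (u t r) <= K * r.
Proof.
  intros Ht Hr.
  assert (Ha2 : 0 < alpha ^ 2) by nra.
  assert (Hder : is_RInt (fun x => sin (u t x) * ur t x) 0 r
    (minus (- cos (u t r)) (- cos (u t 0)))).
  { apply (@is_RInt_derive R_CompleteNormedModule (fun x => - cos (u t x)));
      intros x Hx; rewrite Rmin_left, Rmax_right in Hx by lra;
      assert (HU : U t x) by (apply Omega_U; unfold Omega; lra);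
      destruct (C1on_D 0 0 t x HU) as [_ [Hd [Hc [_ Hcr]]]].
    - evar_last.
      + apply (is_derive_comp (fun y => - cos y) (fun x => u t x) x (sin (u t x)));
          [auto_derive; [auto|ring]|exact Hd].
      + unfold scal; simpl; unfold mult; simpl. apply Rmult_comm.
    - apply (@continuous_mult R_UniformSpace R_AbsRing).
      + apply (continuous_comp (fun x => u t x) sin); [apply cont2_section, Hc|].
        apply continuity_pt_filterlim, continuity_sin.
      + apply cont2_section, Hcr. }
  rewrite axis, cos_0 in Hder by lra.
  assert (Hle : RInt (fun x => sin (u t x) * ur t x) 0 r
    <= RInt (fun x => (r / alpha ^ 2) * e t x + / (2 * r) * x) 0 r).
  { assert (He : ex_RInt (e t) 0 r) by (apply energy_density_ex_RInt; lra).
    apply RInt_le; [lra|eexists; exact Hder| |].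
    - apply (@ex_RInt_plus R_NormedModule).
      + apply (@ex_RInt_scal R_NormedModule). exact He.
      + apply (@ex_RInt_scal R_NormedModule (fun x => x)).
        apply (@ex_RInt_continuous R_CompleteNormedModule). intros. apply continuous_id.
    - intros x Hx. rewrite energy_density_split by lra.
      assert (Hs := sin_sqr_div_ge0 t x (proj1 Hx)).
      assert (Hr2 : 0 < r / alpha ^ 2) by (apply Rdiv_lt_0_compat; lra).
      assert (H1 : alpha ^ 2 * sin (u t x) ^ 2 / x * ur t x ^ 2
        <= rF t x * (ut t x ^ 2 + ur t x ^ 2)).
      { unfold rF. assert (Hq : 0 <= alpha ^ 2 * sin (u t x) ^ 2 / x).
        { apply Rmult_le_pos; [nra|]. apply Rlt_le, Rinv_0_lt_compat. lra. }
        assert (0 <= ut t x ^ 2) by nra. assert (0 <= ur t x ^ 2) by nra. nra. }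
      (* Arithmetic-geometric mean inequality for [sin u u_r], with a weight proportional to [r]:
         both resulting integrals are then linear in [r], namely [r / alpha^2] times an energy, and
         [r / 4]. Their sum is the origin of [K]. *)
      apply Rle_trans with (r / alpha ^ 2 *
        (alpha ^ 2 * sin (u t x) ^ 2 / x * ur t x ^ 2 / 2) + / (2 * r) * x).
      + replace (r / alpha ^ 2 *
          (alpha ^ 2 * sin (u t x) ^ 2 / x * ur t x ^ 2 / 2) + / (2 * r) * x)
          with (sin (u t x) * ur t x
            + (r * (sin (u t x) * ur t x) - x) ^ 2 * / (2 * r * x)).
        2: { field. lra. }
        assert (0 <= (r * (sin (u t x) * ur t x) - x) ^ 2 * / (2 * r * x)); [|lra].
        apply Rmult_le_pos; [apply pow2_ge_0|]. apply Rlt_le, Rinv_0_lt_compat. nra.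
      + apply Rplus_le_compat_r, Rmult_le_compat_l; lra. }
  rewrite (is_RInt_unique _ _ _ _ Hder) in Hle.
  rewrite (@RInt_plus R_CompleteNormedModule (fun x => r / alpha ^ 2 * e t x)
    (fun x => / (2 * r) * x)) in Hle.
  2: { apply (@ex_RInt_scal R_NormedModule), energy_density_ex_RInt; lra. }
  2: { apply (@ex_RInt_scal R_NormedModule (fun x => x)).
       apply (@ex_RInt_continuous R_CompleteNormedModule). intros. apply continuous_id. }
  rewrite (@RInt_scal R_CompleteNormedModule (e t)) in Hle
    by (apply energy_density_ex_RInt; lra).
  assert (Hid : is_RInt (fun x => / (2 * r) * x) 0 r
    (minus (r ^ 2 / (4 * r)) (0 ^ 2 / (4 * r)))).
  { apply (@is_RInt_derive R_CompleteNormedModule (fun x => x ^ 2 / (4 * r))).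
    - intros x _. auto_derive; [auto|field; lra].
    - intros x _. apply (@continuous_mult R_UniformSpace R_AbsRing);
        [apply continuous_const|apply continuous_id]. }
  rewrite (is_RInt_unique _ _ _ _ Hid) in Hle.
  unfold minus, plus, opp, scal in Hle; simpl in Hle; unfold mult in Hle; simpl in Hle.
  assert (Hrt : RInt (e t) 0 r <= E (T0 / 2)).
  { apply Rle_trans with (E t); [|apply energy_mono; lra].
    assert (Hsplit : E t = RInt (e t) 0 r + RInt (e t) r t).
    { unfold E. symmetry.
      apply (@RInt_Chasles R_CompleteNormedModule); apply energy_density_ex_RInt; lra. }
    assert (0 <= RInt (e t) r t); [|lra].
    apply RInt_ge_0; [lra|apply energy_density_ex_RInt; lra|].
    intros x Hx. apply energy_density_ge0. lra. }
  assert (Hra : 0 < r / alpha ^ 2) by (apply Rdiv_lt_0_compat; lra).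
  assert (Hf : r / alpha ^ 2 * RInt (e t) 0 r <= r / alpha ^ 2 * E (T0 / 2))
    by (apply Rmult_le_compat_l; lra).
  unfold K.
  replace ((E (T0 / 2) / alpha ^ 2 + / 4) * r)
    with (r / alpha ^ 2 * E (T0 / 2) + r / 4) by (field; lra).
  replace (r * (r * 1) / (4 * r)) with (r / 4) in Hle by (field; lra).
  replace (0 * (0 * 1) / (4 * r)) with 0 in Hle by (field; lra).
  change (alpha * (alpha * 1)) with (alpha ^ 2) in Hle. lra.
Qed.

Lemma sin_sqr_le t r : 0 < t <= T0 / 2 -> 0 < r <= t ->
  sin (u t r) ^ 2 <= 2 * K * r.
Proof.
  intros Ht Hr. assert (H := one_minus_cos_le t r Ht Hr).
  assert (Hb := COS_bound (u t r)). assert (Hsc := sin2_cos2 (u t r)).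
  unfold Rsqr in Hsc. nra.
Qed.

(** * Decay in the exterior region *)

(** [inflow] sees waves moving towards the axis (functions of [t + r]), [outflow] those moving away
    from it. Their sum is twice the kinetic part of [e], and [inflow] on [r = t] is bounded by
    [cone_flux]. *)
Definition inflow (t r : R) : R := rF t r * (ut t r + ur t r) ^ 2 / 2.
Definition outflow (t r : R) : R := rF t r * (ut t r - ur t r) ^ 2 / 2.

Lemma inflow_ge0 t r : 0 < r -> 0 <= inflow t r.
Proof.
  intro Hr. unfold inflow. assert (H := rF_ge t r Hr).
  assert (0 <= rF t r * (ut t r + ur t r) ^ 2); [|lra].
  apply Rmult_le_pos; [lra|apply pow2_ge_0].
Qed.

Lemma outflow_ge0 t r : 0 < r -> 0 <= outflow t r.
Proof.
  intro Hr. unfold outflow. assert (H := rF_ge t r Hr).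
  assert (0 <= rF t r * (ut t r - ur t r) ^ 2); [|lra].
  apply Rmult_le_pos; [lra|apply pow2_ge_0].
Qed.

(** Multiply the equation by [r (u_t + u_r)] and by [r (u_t - u_r)]. The bilinear terms are
    opposite, and [r] times their coefficient [1 - alpha^2 sin^2 u / r^2] is at most [rF] in
    absolute value: the coupling costs [1/r] and does not see the size of the quasilinear factor. *)
Lemma transport : exists Pt Pr Qt Qr,
  C1on off_axis inflow Pt Pr /\ C1on off_axis outflow Qt Qr /\
  forall t r, 0 < t <= T0 -> 0 < r <= t ->
    Pt t r - Pr t r =
      - (1 - alpha ^ 2 * sin (u t r) ^ 2 / r ^ 2)
        * ((ut t r + ur t r) * (ut t r - ur t r)) / 2
      - sin (u t r) * cos (u t r) * (ut t r + ur t r) / r /\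
    Qt t r + Qr t r =
      (1 - alpha ^ 2 * sin (u t r) ^ 2 / r ^ 2)
        * ((ut t r + ur t r) * (ut t r - ur t r)) / 2
      - sin (u t r) * cos (u t r) * (ut t r - ur t r) / r.
Proof.
  do 4 eexists. split; [unfold inflow, rF; C1on_solve|].
  split; [unfold outflow, rF; C1on_solve|].
  intros t r Ht Hr. cbv beta.
  assert (HP := pde t r Ht Hr). unfold skyrme_eq in HP. cbv zeta in HP.
  rewrite sin_2a in HP.
  split; apply Rminus_diag_uniq.
  - match type of HP with ?x = 0 =>
      transitivity (r * (ut t r + ur t r) * x) end.
    + field. lra.
    + rewrite HP. ring.
  - match type of HP with ?x = 0 =>
      transitivity (r * (ut t r - ur t r) * x) end.
    + field. lra.
    + rewrite HP. ring.
Qed.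

(* Null coordinates [eta = t + r] and [xi = t - r]; the tip of the cone is
   [eta = 0] and its boundary [xi = 0]. *)
Local Notation null f :=
  (fun eta xi => f (/ 2 * eta + / 2 * xi) (/ 2 * eta + - / 2 * xi)).

(** The logarithmic derivatives are [mu xi1 / eta^2] in [eta] and [- mu / xi1] in [xi]. Their
    geometric mean [mu / eta] matches a coupling of size [1/r], while the exponent stays between
    [- 2 mu] and [0] for [0 <= xi <= xi1 <= eta]. *)
Definition weight (mu xi1 eta xi : R) : R :=
  exp (- mu * (xi * / xi1) - mu * xi1 * / eta).

(* The cross terms [p q] and [sin u p], [sin u q] are absorbed by the derivative
   of the weight, which is monotone along both null directions. *)
Lemma null_source_bound (r eta xi1 g k rf s c p q y : R) :
  0 < xi1 -> 0 < g -> xi1 <= eta -> g * eta / 2 <= r -> r <= rf ->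
  Rabs (r * (1 - y)) <= rf -> s ^ 2 <= 2 * k * r -> 0 < k -> c ^ 2 <= 1 ->
  - (4 * k / (g ^ 2 * xi1)) <=
    (1 + / g) * (xi1 / eta ^ 2 * (rf * q ^ 2 / 2) + / xi1 * (rf * p ^ 2 / 2))
    + / 2 * ((1 - y) * (p * q) - s * c * (q - p) / r).
Proof.
  intros Hxi Hg Hxe Hr Hrf Hy Hs Hk Hc.
  assert (Heta : 0 < eta) by lra.
  assert (Hge : 0 < g * eta / 2) by nra.
  assert (Hr0 : 0 < r) by lra.
  set (Q := rf * q ^ 2 / 2). set (P := rf * p ^ 2 / 2).
  set (A := xi1 / eta ^ 2). set (B := / xi1).
  assert (HA : 0 < A) by (apply Rdiv_lt_0_compat; nra).
  assert (HB : 0 < B) by (apply Rinv_0_lt_compat; lra).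
  assert (HQ0 : r * q ^ 2 / 2 <= Q)
    by (unfold Q; assert (0 <= q ^ 2) by nra; nra).
  assert (HP0 : r * p ^ 2 / 2 <= P)
    by (unfold P; assert (0 <= p ^ 2) by nra; nra).
  assert (HQ : 0 <= Q) by (assert (0 <= q ^ 2) by nra; nra).
  assert (HP : 0 <= P) by (assert (0 <= p ^ 2) by nra; nra).
  assert (Hinvr : / r <= 2 / (g * eta)).
  { replace (2 / (g * eta)) with (/ (g * eta / 2)) by (field; lra).
    apply Rinv_le_contravar; lra. }
  assert (Hir : 0 < / r) by (apply Rinv_0_lt_compat; lra).
  (* Origin of [1 + / g]: after the common factor [/ 2], the product [p q] uses [/ g] copies of
     [A Q + B P], and the two terms with [sin u] together use half a copy more. *)
  assert (H1 : Rabs ((1 - y) * (p * q)) <= 2 / g * (A * Q + B * P)).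
  { apply Rle_trans with (/ r * (xi1 / eta * Q + eta / xi1 * P)).
    - apply Rmult_le_reg_l with r; [exact Hr0|].
      replace (r * (/ r * (xi1 / eta * Q + eta / xi1 * P)))
        with (xi1 / eta * Q + eta / xi1 * P) by (field; lra).
      rewrite <- (Rabs_pos_eq r) at 1 by lra. rewrite <- Rabs_mult, <- Rmult_assoc, Rabs_mult.
      apply Rle_trans with (rf * Rabs (p * q)).
      { apply Rmult_le_compat_r; [apply Rabs_pos|exact Hy]. }
      replace (xi1 / eta * Q + eta / xi1 * P)
        with (rf * (xi1 / eta * q ^ 2 / 2 + eta / xi1 * p ^ 2 / 2))
        by (unfold Q, P; field; lra).
      apply Rmult_le_compat_l; [lra|]. rewrite Rabs_mult.
      rewrite <- (pow2_abs q), <- (pow2_abs p).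
      set (a := Rabs q). set (b := Rabs p).
      replace (xi1 / eta * a ^ 2 / 2 + eta / xi1 * b ^ 2 / 2)
        with (b * a + (xi1 * a - eta * b) ^ 2 * / (2 * xi1 * eta)) by (field; lra).
      assert (0 <= (xi1 * a - eta * b) ^ 2 * / (2 * xi1 * eta)); [|lra].
      apply Rmult_le_pos; [apply pow2_ge_0|].
      apply Rlt_le, Rinv_0_lt_compat. nra.
    - replace (2 / g * (A * Q + B * P))
        with (2 / (g * eta) * (xi1 / eta * Q + eta / xi1 * P))
        by (unfold A, B; field; lra).
      apply Rmult_le_compat_r; [|exact Hinvr].
      assert (0 < xi1 / eta) by (apply Rdiv_lt_0_compat; lra).
      assert (0 < eta / xi1) by (apply Rdiv_lt_0_compat; lra). nra. }
  assert (Hsr : (s * c) ^ 2 / r <= 2 * k).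
  { apply Rmult_le_reg_r with r; [exact Hr0|].
    replace ((s * c) ^ 2 / r * r) with (s ^ 2 * c ^ 2) by (field; lra).
    assert (0 <= s ^ 2) by nra. nra. }
  assert (Hsr0 : 0 <= (s * c) ^ 2 / r)
    by (apply Rmult_le_pos; [apply pow2_ge_0|lra]).
  assert (Hr2 : / r ^ 2 <= 4 / (g ^ 2 * eta ^ 2)).
  { replace (4 / (g ^ 2 * eta ^ 2)) with (/ (g * eta / 2) ^ 2) by (field; lra).
    apply Rinv_le_contravar; [apply pow_lt; lra|].
    apply pow_incr. lra. }
  assert (Hir2 : 0 < / r ^ 2) by (apply Rinv_0_lt_compat; nra).
  assert (Ham : forall z w, 0 < w ->
    Rabs (s * c * z / r) <= w * (r * z ^ 2 / 2) + k * / w * / r ^ 2).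
  { intros z w Hw.
    apply Rle_trans with (w * (r * z ^ 2 / 2) + ((s * c) ^ 2 / r / 2) * / w * / r ^ 2).
    - apply Rabs_le.
      replace (w * (r * z ^ 2 / 2) + (s * c) ^ 2 / r / 2 * / w * / r ^ 2)
        with (s * c * z / r + (w * r ^ 2 * z - s * c) ^ 2 * / (2 * w * r ^ 3))
        at 2 by (field; lra).
      replace (w * (r * z ^ 2 / 2) + (s * c) ^ 2 / r / 2 * / w * / r ^ 2)
        with (- (s * c * z / r) + (w * r ^ 2 * z + s * c) ^ 2 * / (2 * w * r ^ 3))
        by (field; lra).
      assert (Hi : 0 < / (2 * w * r ^ 3)).
      { apply Rinv_0_lt_compat. assert (0 < r ^ 3) by (apply pow_lt; lra). nra. }
      assert (0 <= (w * r ^ 2 * z - s * c) ^ 2 * / (2 * w * r ^ 3))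
        by (apply Rmult_le_pos; [apply pow2_ge_0|lra]).
      assert (0 <= (w * r ^ 2 * z + s * c) ^ 2 * / (2 * w * r ^ 3))
        by (apply Rmult_le_pos; [apply pow2_ge_0|lra]).
      lra.
    - apply Rplus_le_compat_l. apply Rmult_le_compat_r; [lra|].
      apply Rmult_le_compat_r; [apply Rlt_le, Rinv_0_lt_compat, Hw|lra]. }
  assert (H2 : Rabs (s * c * q / r) <= A * Q + 4 * k / (g ^ 2 * xi1)).
  { eapply Rle_trans; [apply (Ham q A HA)|]. apply Rplus_le_compat; [nra|].
    replace (4 * k / (g ^ 2 * xi1)) with (k * / A * (4 / (g ^ 2 * eta ^ 2)))
      by (unfold A; field; lra).
    apply Rmult_le_compat_l; [|exact Hr2].
    assert (0 < / A) by (apply Rinv_0_lt_compat, HA). nra. }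
  assert (H3 : Rabs (s * c * p / r) <= B * P + 4 * k / (g ^ 2 * xi1)).
  { eapply Rle_trans; [apply (Ham p B HB)|]. apply Rplus_le_compat; [nra|].
    apply Rle_trans with (k * / B * (4 / (g ^ 2 * eta ^ 2))).
    - apply Rmult_le_compat_l; [|exact Hr2].
      assert (0 < / B) by (apply Rinv_0_lt_compat, HB). nra.
    - unfold B. rewrite Rinv_inv.
      replace (k * xi1 * (4 / (g ^ 2 * eta ^ 2)))
        with (4 * k / (g ^ 2 * xi1) * (xi1 / eta) ^ 2) by (field; lra).
      rewrite <- (Rmult_1_r (4 * k / (g ^ 2 * xi1))) at 2.
      apply Rmult_le_compat_l.
      + apply Rlt_le, Rdiv_lt_0_compat; [lra|]. assert (0 < g ^ 2) by nra. nra.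
      + assert (Hq : 0 < xi1 / eta <= 1); [|nra].
        split; [apply Rdiv_lt_0_compat; lra|].
        apply Rmult_le_reg_r with eta; [lra|]. unfold Rdiv.
        rewrite Rmult_assoc, Rinv_l by lra. lra. }
  apply Rabs_le_between in H1. apply Rabs_le_between in H2. apply Rabs_le_between in H3.
  replace (s * c * (q - p) / r) with (s * c * q / r - s * c * p / r) by (field; lra).
  replace (2 / g) with (2 * / g) in H1 by reflexivity.
  set (Z := A * Q + B * P) in *.
  assert (HZ : 0 <= Z) by (unfold Z; nra).
  fold Q P A B. fold Z.
  assert (0 < / g) by (apply Rinv_0_lt_compat, Hg).
  unfold Z in *. nra.
Qed.

Lemma null_off_axis eta xi : 0 < eta -> 0 <= xi < eta -> eta + xi <= 2 * T0 ->
  0 < / 2 * eta + / 2 * xi <= T0 /\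
  0 < / 2 * eta + - / 2 * xi <= / 2 * eta + / 2 * xi.
Proof. intros; lra. Qed.

(** In null coordinates the [eta]-derivative of [outflow] is paired with the [xi]-derivative of
    [inflow], so [inflow] appears at both ends: at [xi = xi1] with a favourable sign, at [xi = 0]
    bounded by the cone flux. The condition on [xi1] keeps [r >= (1 - kap) eta / 2]. *)
Lemma weighted_outflow_derive (kap xi1 eta : R) :
  0 < kap < 1 -> 0 < xi1 -> xi1 <= kap * eta -> eta <= T0 / 2 ->
  exists d,
    is_derive (fun x => RInt (fun xi =>
      weight (1 + / (1 - kap)) xi1 x xi * null outflow x xi) 0 xi1) eta d /\
    - cone_flux (eta / 2) - 4 * K / (1 - kap) ^ 2 <= d.
Proof.
  intros Hkap Hxi1 Hxi Heta.
  set (mu := 1 + / (1 - kap)).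
  assert (Hg : 0 < / (1 - kap)) by (apply Rinv_0_lt_compat; lra).
  assert (Hmu : 0 < mu) by (unfold mu; lra).
  assert (Heta0 : 0 < eta) by nra.
  assert (Hxe : xi1 < eta) by nra.
  assert (HK : 0 < K) by (apply K_pos; lra).
  destruct transport as (Pt & Pr & Qt & Qr & HP & HQ & Htr).
  set (W := fun x y => off_axis (/ 2 * x + / 2 * y) (/ 2 * x + - / 2 * y) /\ 0 < x).
  assert (HW : open2 W).
  { apply open2_and; [apply (open2_comp_lin off_axis), off_axis_open|].
    intros x y Hx. exists x. split; [exact Hx|]. intros x' y' H _.
    apply Rabs_def2 in H. lra. }
  assert (HPn := C1on_comp_lin _ _ _ _ (/ 2) (/ 2) (/ 2) (- / 2) off_axis_open HP).
  assert (HQn := C1on_comp_lin _ _ _ _ (/ 2) (/ 2) (/ 2) (- / 2) off_axis_open HQ).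
  apply (C1on_sub W) in HPn; [|intros x y [H _]; exact H].
  apply (C1on_sub W) in HQn; [|intros x y [H _]; exact H].
  assert (Hw : C1on W (weight mu xi1)
    (fun x y => mu * xi1 * / x ^ 2 * weight mu xi1 x y)
    (fun x y => - mu * / xi1 * weight mu xi1 x y)).
  { assert (Hw : exists wt wr, C1on W (weight mu xi1) wt wr /\
      (forall x y, W x y -> wt x y = mu * xi1 * / x ^ 2 * weight mu xi1 x y) /\
      (forall x y, W x y -> wr x y = - mu * / xi1 * weight mu xi1 x y)).
    { do 2 eexists. split; [|split].
      - unfold weight. C1on_auto; intros x y [_ H]; lra.
      - intros x y [_ H]. unfold weight. field. lra.
      - intros x y [_ H]. unfold weight. field. lra. }
    destruct Hw as (wt & wr & Hw & E1 & E2).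
    intros x y H. destruct (Hw x y H) as [F1 [F2 [F3 [F4 F5]]]].
    rewrite <- E1, <- E2 by exact H.
    split; [exact F1|]. split; [exact F2|]. split; [exact F3|].
    assert (Hl : forall f g : R -> R -> R, (forall x y, W x y -> f x y = g x y) ->
      continuity_2d_pt f x y -> continuity_2d_pt g x y).
    { intros f g Hfg. apply continuity_2d_pt_ext_loc.
      destruct (HW x y H) as [d [Hd Hb]]. exists (mkposreal d Hd).
      intros a b Ha Hb'. apply Hfg, Hb; assumption. }
    split; [apply (Hl _ _ E1 F4)|apply (Hl _ _ E2 F5)]. }
  assert (HA := C1on_mult W _ _ _ _ _ _ Hw HQn).
  assert (HB := C1on_mult W _ _ _ _ _ _ Hw HPn).
  assert (Hseg : forall xi, 0 <= xi <= xi1 -> W eta xi).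
  { intros xi Hx. destruct (null_off_axis eta xi) as [N1 N2]; try lra.
    split; [apply cone_off_axis; lra|exact Heta0]. }
  assert (Hder := slice_derive W _ _ _ _ _ _ (fun _ => 0) (fun _ => xi1) 0 0 eta
    HW HA HB (is_derive_const (0 : R_NormedModule) eta)
    (is_derive_const (xi1 : R_NormedModule) eta) (Rlt_le _ _ Hxi1) Hseg).
  cbv beta in Hder.
  eexists. split; [exact Hder|].
  match goal with |- context [RInt ?f 0 xi1] => set (S := f) end.
  assert (HexS : ex_RInt S 0 xi1).
  { apply (@ex_RInt_continuous R_CompleteNormedModule). intros z Hz.
    rewrite Rmin_left, Rmax_right in Hz by lra. specialize (Hseg z Hz).
    apply (@continuous_minus R_UniformSpace R_AbsRing R_NormedModule).
    - apply (cont2_section (fun x y => mu * xi1 * / x ^ 2 * weight mu xi1 x y *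
        outflow (/ 2 * x + / 2 * y) (/ 2 * x + - / 2 * y) +
        weight mu xi1 x y * (Qt (/ 2 * x + / 2 * y) (/ 2 * x + - / 2 * y) * / 2 +
          Qr (/ 2 * x + / 2 * y) (/ 2 * x + - / 2 * y) * / 2))).
      apply (HA eta z Hseg).
    - apply (cont2_section (fun x y => - mu * / xi1 * weight mu xi1 x y *
        inflow (/ 2 * x + / 2 * y) (/ 2 * x + - / 2 * y) +
        weight mu xi1 x y * (Pt (/ 2 * x + / 2 * y) (/ 2 * x + - / 2 * y) * / 2 +
          Pr (/ 2 * x + / 2 * y) (/ 2 * x + - / 2 * y) * - / 2))).
      apply (HB eta z Hseg). }
  assert (Hwb : forall xi, 0 <= xi -> 0 < weight mu xi1 eta xi <= 1).
  { intros xi Hx. unfold weight. split; [apply exp_pos|].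
    rewrite <- exp_0. apply exp_le_compat.
    assert (0 <= xi * / xi1)
      by (apply Rmult_le_pos; [lra|apply Rlt_le, Rinv_0_lt_compat; lra]).
    assert (0 < / eta) by (apply Rinv_0_lt_compat; lra).
    assert (0 < mu * xi1) by nra.
    assert (0 <= mu * xi1 * / eta) by nra. nra. }
  assert (HS : forall xi, 0 < xi < xi1 -> - (4 * K / ((1 - kap) ^ 2 * xi1)) <= S xi).
  { intros xi Hx. unfold S. clear S HexS Hder HA HB Hw HPn HQn.
    destruct (null_off_axis eta xi) as [N1 N2]; try lra.
    set (t := / 2 * eta + / 2 * xi) in *. set (r := / 2 * eta + - / 2 * xi) in *.
    destruct (Htr t r N1 N2) as [TP TQ].
    assert (Hb := null_source_bound r eta xi1 (1 - kap) K (rF t r) (sin (u t r))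
      (cos (u t r)) (ut t r + ur t r) (ut t r - ur t r)
      (alpha ^ 2 * sin (u t r) ^ 2 / r ^ 2)).
    match goal with |- _ <= ?x =>
      replace x with (weight mu xi1 eta xi *
        ((1 + / (1 - kap)) *
          (xi1 / eta ^ 2 * (rF t r * (ut t r - ur t r) ^ 2 / 2)
           + / xi1 * (rF t r * (ut t r + ur t r) ^ 2 / 2))
         + / 2 * ((1 - alpha ^ 2 * sin (u t r) ^ 2 / r ^ 2)
             * ((ut t r + ur t r) * (ut t r - ur t r))
           - sin (u t r) * cos (u t r) * ((ut t r - ur t r) - (ut t r + ur t r)) / r)))
    end.
    2: { replace (Qt t r * / 2 + Qr t r * / 2) with (/ 2 * (Qt t r + Qr t r)) by ring.
         replace (Pt t r * / 2 + Pr t r * - / 2) with (/ 2 * (Pt t r - Pr t r)) by ring.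
         rewrite TP, TQ. unfold mu, inflow, outflow. field. lra. }
    assert (HC : 0 < 4 * K / ((1 - kap) ^ 2 * xi1)).
    { apply Rdiv_lt_0_compat; [lra|]. apply Rmult_lt_0_compat; [apply pow_lt; lra|lra]. }
    assert (Hbb : - (4 * K / ((1 - kap) ^ 2 * xi1)) <=
        ((1 + / (1 - kap)) *
          (xi1 / eta ^ 2 * (rF t r * (ut t r - ur t r) ^ 2 / 2)
           + / xi1 * (rF t r * (ut t r + ur t r) ^ 2 / 2))
         + / 2 * ((1 - alpha ^ 2 * sin (u t r) ^ 2 / r ^ 2)
             * ((ut t r + ur t r) * (ut t r - ur t r))
           - sin (u t r) * cos (u t r) * ((ut t r - ur t r) - (ut t r + ur t r)) / r))).
    { apply Hb; try lra.
      - unfold r. nra.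
      - apply rF_ge. lra.
      - replace (r * (1 - alpha ^ 2 * sin (u t r) ^ 2 / r ^ 2))
          with (r - alpha ^ 2 * sin (u t r) ^ 2 / r) by (field; lra).
        assert (0 <= alpha ^ 2 * sin (u t r) ^ 2 / r).
        { apply Rmult_le_pos; [nra|]. apply Rlt_le, Rinv_0_lt_compat. lra. }
        unfold rF. apply Rabs_le. lra.
      - apply sin_sqr_le; unfold t in *; lra.
      - assert (Hcb := COS_bound (u t r)). nra. }
    specialize (Hwb xi (Rlt_le _ _ (proj1 Hx))).
    set (w := weight mu xi1 eta xi) in *. nra. }
  (* The pointwise loss is of order [1 / xi1] on an interval of length [xi1], so the total does not
     depend on [xi1]. *)
  assert (HRS : - (4 * K / (1 - kap) ^ 2) <= RInt S 0 xi1).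
  { apply Rle_trans with (RInt (fun _ => - (4 * K / ((1 - kap) ^ 2 * xi1))) 0 xi1).
    - rewrite RInt_const_R. right. field. lra.
    - apply RInt_le; [lra|apply ex_RInt_const|exact HexS|exact HS]. }
  assert (Hb0 : inflow (eta / 2) (eta / 2) <= cone_flux (eta / 2))
    by (apply cone_flux_ge; lra).
  replace (/ 2 * eta + / 2 * 0) with (eta / 2) by field.
  replace (/ 2 * eta + - / 2 * 0) with (eta / 2) by field.
  assert (H1 := Hwb xi1 (Rlt_le _ _ Hxi1)). assert (H0 := Hwb 0 (Rle_refl 0)).
  assert (I1 : 0 <= inflow (/ 2 * eta + / 2 * xi1) (/ 2 * eta + - / 2 * xi1))
    by (apply inflow_ge0; lra).
  assert (I0 : 0 <= inflow (eta / 2) (eta / 2)) by (apply inflow_ge0; lra).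
  assert (0 <= weight mu xi1 eta xi1 *
    inflow (/ 2 * eta + / 2 * xi1) (/ 2 * eta + - / 2 * xi1))
    by (apply Rmult_le_pos; lra).
  assert (weight mu xi1 eta 0 * inflow (eta / 2) (eta / 2)
    <= 1 * inflow (eta / 2) (eta / 2)) by (apply Rmult_le_compat_r; lra).
  lra.
Qed.

Lemma null_outflow_C1 : exists ft fr,
  C1on (fun x y => off_axis (/ 2 * x + / 2 * y) (/ 2 * x + - / 2 * y))
    (null outflow) ft fr.
Proof.
  destruct transport as (_ & _ & Qt & Qr & _ & HQ & _).
  do 2 eexists.
  exact (C1on_comp_lin _ _ _ _ (/ 2) (/ 2) (/ 2) (- / 2) off_axis_open HQ).
Qed.

Lemma null_outflow_ex_RInt eta b : 0 < eta -> 0 <= b < eta -> eta <= T0 / 2 ->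
  ex_RInt (fun xi => null outflow eta xi) 0 b.
Proof.
  intros Heta Hb HT. destruct null_outflow_C1 as (ft & fr & HC).
  apply (C1on_section_ex_RInt _ (null outflow) ft fr eta 0 b HC); [lra|].
  intros xi Hx. destruct (null_off_axis eta xi) as [N1 N2]; try lra.
  apply cone_off_axis; lra.
Qed.

Lemma weight_bounds mu xi1 eta xi : 0 < mu -> 0 < xi1 -> xi1 <= eta -> 0 <= xi <= xi1 ->
  exp (- (2 * mu)) <= weight mu xi1 eta xi <= 1.
Proof.
  intros Hmu Hxi1 Heta Hxi. unfold weight.
  assert (H1 : 0 <= xi * / xi1 <= 1).
  { split; [apply Rmult_le_pos; [lra|apply Rlt_le, Rinv_0_lt_compat; lra]|].
    apply Rmult_le_reg_r with xi1; [lra|]. rewrite Rmult_assoc, Rinv_l by lra. lra. }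
  assert (H2 : 0 <= xi1 * / eta <= 1).
  { split; [apply Rmult_le_pos; [lra|apply Rlt_le, Rinv_0_lt_compat; lra]|].
    apply Rmult_le_reg_r with eta; [lra|]. rewrite Rmult_assoc, Rinv_l by lra. lra. }
  rewrite Rmult_assoc. split.
  - apply exp_le_compat. nra.
  - rewrite <- exp_0. apply exp_le_compat. nra.
Qed.

(** [xi1 = kap eta] is frozen at the target and the weighted integral is propagated from a fixed
    later [eta0] down to [eta]. The bound is four times [eps']: one for the data at [eta0], two for
    the oscillation of [2 E], one for [C eta0]. The factor [exp (- (2 * mu))] in [eps'] removes the
    weight. *)
Lemma null_outflow_decay kap eps : 0 < T0 -> 0 < kap < 1 -> 0 < eps ->
  exists d, 0 < d <= T0 / 2 /\ forall eta, 0 < eta < d ->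
    RInt (fun xi => null outflow eta xi) 0 (kap * eta) <= eps.
Proof.
  intros HT0 Hkap Heps.
  set (mu := 1 + / (1 - kap)).
  assert (Hg : 0 < / (1 - kap)) by (apply Rinv_0_lt_compat; lra).
  assert (Hmu : 0 < mu) by (unfold mu; lra).
  assert (HK := K_pos HT0).
  set (C := 4 * K / (1 - kap) ^ 2).
  assert (HC : 0 < C) by (apply Rdiv_lt_0_compat; [lra|apply pow_lt; lra]).
  set (eps' := eps * exp (- (2 * mu)) / 4).
  assert (Hexp := exp_pos (- (2 * mu))).
  assert (Heps' : 0 < eps') by (unfold eps'; nra).
  destruct (energy_oscillation eps' HT0 Heps') as [d0 [Hd0 Hosc]].
  set (eta0 := Rmin d0 (eps' / C)).
  assert (Heta0 : 0 < eta0)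
    by (apply Rmin_pos; [lra|apply Rdiv_lt_0_compat; assumption]).
  assert (Heta0a : eta0 <= d0) by apply Rmin_l.
  assert (Heta0b : C * eta0 <= eps').
  { apply Rle_trans with (C * (eps' / C)).
    - apply Rmult_le_compat_l; [lra|apply Rmin_r].
    - right. field. lra. }
  destruct (bounded_on_rectangle (null outflow) eta0 eta0 0 (kap * eta0))
    as [M [HM Hbd]]; [lra|nra| |].
  { intros t r Ht Hr. destruct null_outflow_C1 as (ft & fr & HCn).
    apply HCn. destruct (null_off_axis t r) as [N1 N2]; try nra.
    apply cone_off_axis; lra. }
  exists (Rmin eta0 (eps' / M)).
  assert (HeM : 0 < eps' / M) by (apply Rdiv_lt_0_compat; assumption).
  assert (Mi1 := Rmin_l eta0 (eps' / M)). assert (Mi2 := Rmin_r eta0 (eps' / M)).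
  split; [split; [apply Rmin_pos; assumption|lra]|].
  intros eta Heta. set (xi1 := kap * eta).
  assert (Hxi1 : 0 < xi1) by (unfold xi1; nra).
  assert (Hxi1e : xi1 < eta) by (unfold xi1; nra).
  set (X := fun x => RInt (fun xi => weight mu xi1 x xi * null outflow x xi) 0 xi1).
  assert (Hex : forall x, eta <= x <= eta0 ->
    ex_RInt (fun xi => weight mu xi1 x xi * null outflow x xi) 0 xi1).
  { intros x Hx. destruct null_outflow_C1 as (ft & fr & HCn).
    apply (@ex_RInt_continuous R_CompleteNormedModule). intros z Hz.
    rewrite Rmin_left, Rmax_right in Hz by lra.
    apply (@continuous_mult R_UniformSpace R_AbsRing).
    - apply (@ex_derive_continuous R_AbsRing R_NormedModule). unfold weight.
      auto_derive. auto.
    - apply (cont2_section (null outflow)), HCn.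
      destruct (null_off_axis x z) as [N1 N2]; try lra. apply cone_off_axis; lra. }
  assert (Hmono : X eta + 2 * E (eta / 2) + C * eta
    <= X eta0 + 2 * E (eta0 / 2) + C * eta0).
  { apply (nondecreasing_of_derive (fun x => X x + 2 * E (x / 2) + C * x)); [lra|].
    intros x Hx.
    destruct (weighted_outflow_derive kap xi1 x) as [d [Hd Hdb]]; try lra.
    { unfold xi1. apply Rmult_le_compat_l; lra. }
    exists (d + cone_flux (x / 2) + C). split; [|unfold C; lra].
    apply (@is_derive_plus R_AbsRing).
    - apply (@is_derive_plus R_AbsRing R_NormedModule X); [exact Hd|].
      evar_last.
      + apply is_derive_scal.
        apply (is_derive_comp E (fun x => x / 2) x (cone_flux (x / 2)) (/ 2)).
        * apply energy_derive. lra.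
        * auto_derive; [auto|field].
      + unfold scal; simpl; unfold mult; simpl. field.
    - auto_derive; [auto|ring]. }
  (* At the fixed [eta0] the integrand is bounded by [M], while the range of integration [xi1]
     shrinks with [eta]. *)
  assert (HX0 : X eta0 <= eps').
  { unfold X. apply Rle_trans with (RInt (fun _ => M) 0 xi1).
    - apply RInt_le; [lra|apply Hex; lra|apply ex_RInt_const|].
      intros z Hz.
      assert (Hz2 : 0 <= z <= kap * eta0) by (unfold xi1 in *; nra).
      assert (B := Hbd eta0 z (conj (Rle_refl _) (Rle_refl _)) Hz2). cbv beta in B.
      assert (Hw := weight_bounds mu xi1 eta0 z).
      apply Rle_trans with (1 * M); [|lra].
      apply Rle_trans with (weight mu xi1 eta0 z * M).
      + apply Rmult_le_compat_l; [lra|].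
        eapply Rle_trans; [apply Rle_abs|exact B].
      + apply Rmult_le_compat_r; lra.
    - rewrite RInt_const_R. apply Rle_trans with (eps' / M * M).
      + apply Rmult_le_compat_r; lra.
      + right. field. lra. }
  assert (HX1 : exp (- (2 * mu)) * RInt (fun xi => null outflow eta xi) 0 xi1 <= X eta).
  { assert (Hexo : ex_RInt (fun xi => null outflow eta xi) 0 xi1)
      by (apply null_outflow_ex_RInt; lra).
    rewrite <- (@RInt_scal R_CompleteNormedModule) by exact Hexo.
    unfold X. apply RInt_le; [lra| |apply Hex; lra|].
    - apply (@ex_RInt_scal R_NormedModule). exact Hexo.
    - intros z Hz. unfold scal; simpl; unfold mult; simpl.
      apply Rmult_le_compat_r; [apply outflow_ge0; lra|].
      apply weight_bounds; lra. }
  assert (HE := Hosc (eta / 2) (eta0 / 2)).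
  assert (Hfin : exp (- (2 * mu)) * RInt (fun xi => null outflow eta xi) 0 xi1
    <= exp (- (2 * mu)) * eps).
  { assert (0 < C * eta) by nra.
    replace (exp (- (2 * mu)) * eps) with (4 * eps') by (unfold eps'; field). lra. }
  apply Rmult_le_reg_l in Hfin; assumption.
Qed.

(** Energy conservation in the triangle between the slice at [T], the cone and the line
    [t + r = (1 + lam) T], which meets the slice at [r = lam T] and the cone at [t = eta / 2]. What
    crosses the line is [outflow], small by the preceding decay, and a potential term. *)
Lemma exterior_decay lam eps : 0 < T0 -> 0 < lam < 1 -> 0 < eps ->
  exists d, 0 < d <= T0 / 2 /\ forall T, 0 < T < d ->
    RInt (e T) (lam * T) T <= eps.
Proof.
  intros HT0 Hlam Heps.
  (* Chosen so that on the line [eta = (1 + lam) T] the slice at [T] is reached at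
     [xi = kap eta = (1 - lam) T]. *)
  set (kap := (1 - lam) / (1 + lam)).
  assert (Hkap : 0 < kap < 1).
  { unfold kap. split; [apply Rdiv_lt_0_compat; lra|].
    apply Rmult_lt_reg_r with (1 + lam); [lra|].
    unfold Rdiv. rewrite Rmult_assoc, Rinv_l by lra. lra. }
  assert (HK := K_pos HT0).
  assert (Heps3 : 0 < eps / 3) by lra.
  destruct (null_outflow_decay kap (eps / 3) HT0 Hkap Heps3) as [d1 [Hd1 Hout]].
  destruct (energy_oscillation (eps / 3) HT0 Heps3) as [d2 [Hd2 Hosc]].
  set (d := Rmin (d1 / 2) (Rmin d2 (eps / (3 * K)))).
  assert (M1 : d <= d1 / 2) by apply Rmin_l.
  assert (M2 : d <= Rmin d2 (eps / (3 * K))) by apply Rmin_r.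
  assert (M3 := Rmin_l d2 (eps / (3 * K))). assert (M4 := Rmin_r d2 (eps / (3 * K))).
  assert (HeK : 0 < eps / (3 * K)) by (apply Rdiv_lt_0_compat; lra).
  exists d. split.
  { split; [|lra]. unfold d. repeat apply Rmin_pos; lra. }
  intros T HT. set (eta := (1 + lam) * T).
  assert (Heta : 0 < eta < 2 * T) by (unfold eta; nra).
  assert (Hkeq : kap * eta = 2 * T - eta) by (unfold kap, eta; field; lra).
  specialize (Hout eta). rewrite Hkeq in Hout.
  set (Y := fun x => RInt (fun xi => null outflow eta xi) 0 x : R).
  assert (HY : forall x, 0 <= x <= 2 * T - eta -> is_derive Y x (null outflow eta x)).
  { intros x Hx. destruct null_outflow_C1 as (ft & fr & HCn).
    assert (Hseg : forall xi, 0 <= xi <= 2 * T - eta ->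
      off_axis (/ 2 * eta + / 2 * xi) (/ 2 * eta + - / 2 * xi)).
    { intros xi Hxi. destruct (null_off_axis eta xi) as [N1 N2]; try (unfold eta in *; nra).
      apply cone_off_axis; lra. }
    destruct (tube _ eta 0 (2 * T - eta)
      (open2_comp_lin off_axis (/ 2) (/ 2) (/ 2) (- / 2) off_axis_open))
      as [g [Hg Htube]]; [lra|exact Hseg|].
    assert (Hcont : forall z, - g < z < 2 * T - eta + g ->
      continuous (fun xi => null outflow eta xi) z).
    { intros z Hz. apply (cont2_section (null outflow)), HCn, Htube; [|lra].
      rewrite Rminus_diag, Rabs_R0. exact Hg. }
    apply (is_derive_RInt (fun xi => null outflow eta xi) Y 0 x).
    - exists (mkposreal g Hg). intros y Hy. change (Rabs (y - x) < g) in Hy.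
      apply Rabs_def2 in Hy.
      apply (@RInt_correct R_CompleteNormedModule).
      apply (@ex_RInt_continuous R_CompleteNormedModule). intros z Hz.
      apply Hcont. revert Hz. unfold Rmin, Rmax. destruct (Rle_dec 0 y); lra.
    - apply Hcont. lra. }
  (* The slice from [eta - x] to [x] starts as a point at [x = eta / 2]. Its energy grows by the
     cone flux, by [outflow] on the line, and by [sin^2 u / (2 r) <= K]; the three added terms grow
     at least as fast. *)
  assert (Hmono : E (eta / 2) + Y (2 * (eta / 2) - eta) / 2 + K * (eta / 2)
      - RInt (e (eta / 2)) (eta - eta / 2) (eta / 2)
    <= E T + Y (2 * T - eta) / 2 + K * T - RInt (e T) (eta - T) T).
  { apply (nondecreasing_of_derive
      (fun x => E x + Y (2 * x - eta) / 2 + K * x - RInt (e x) (eta - x) x)); [lra|].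
    intros x Hx.
    assert (Hl : 0 < eta - x) by (unfold eta in *; nra).
    destruct (balance_slice _ _ _ (fun x => eta - x) (fun x => x) (- 1) 1 x energy_balance)
      as [_ HW]; try lra.
    { auto_derive; [auto|ring]. }
    { apply (@is_derive_id R_AbsRing). }
    cbv beta in HW. rewrite RInt_const_R in HW.
    eexists. split.
    - apply (@is_derive_minus R_AbsRing R_NormedModule); [|exact HW].
      apply (@is_derive_plus R_AbsRing R_NormedModule).
      + apply (@is_derive_plus R_AbsRing R_NormedModule); [apply energy_derive; lra|].
        apply (is_derive_ext (fun x => / 2 * Y (2 * x - eta)));
          [intro y; unfold Rdiv; apply Rmult_comm|].
        apply is_derive_scal.
        apply (is_derive_comp Y (fun x => 2 * x - eta) x
          (null outflow eta (2 * x - eta)) 2);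
          [apply HY; lra|auto_derive; [auto|ring]].
      + apply (is_derive_ext (fun x => scal x K)); [intro y; apply Rmult_comm|].
        apply (@is_derive_scal_l R_AbsRing R_NormedModule (fun x => x) x 1).
        apply (@is_derive_id R_AbsRing).
    - rewrite !energy_density_split by lra.
      unfold minus, plus, opp, scal; simpl; unfold mult; simpl.
      replace (/ 2 * eta + / 2 * (2 * x - eta)) with x by field.
      replace (/ 2 * eta + - / 2 * (2 * x - eta)) with (eta - x) by field.
      assert (Hs := sin_sqr_le x (eta - x)).
      assert (Hs2 : sin (u x (eta - x)) ^ 2 / (2 * (eta - x)) <= K).
      { apply Rmult_le_reg_r with (2 * (eta - x)); [lra|].
        unfold Rdiv. rewrite Rmult_assoc, Rinv_l by lra. lra. }
      unfold cone_flux, outflow. simpl in *. nra. }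
  replace (eta - eta / 2) with (eta / 2) in Hmono by field.
  replace (eta - T) with (lam * T) in Hmono by (unfold eta; ring).
  replace (2 * (eta / 2) - eta) with 0 in Hmono by field.
  unfold Y in Hmono. rewrite !RInt_point in Hmono.
  change (@zero R_CompleteNormedModule) with 0 in Hmono.
  assert (HE := Hosc (eta / 2) T).
  assert (HKT : K * T <= eps / 3).
  { apply Rle_trans with (K * (eps / (3 * K))).
    - apply Rmult_le_compat_l; lra.
    - right. field. lra. }
  assert (0 < K * (eta / 2)) by nra.
  lra.
Qed.

(** * Morawetz estimate *)

(** Origin of [9]: with [r - Y <= r k] and [c <= 1], the [Y b^2] terms leave at least [9 - 6 = 3].
    One copy belongs to the energy and two absorb the cross term. The bound [c >= / 2] serves
    [r b^2], with coefficient at least [3 c], and [Y a^2], with coefficient [2 c]. *)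
Lemma morawetz_source_algebra (r f Y s c a b : R) :
  0 < r -> 0 <= Y -> f = r + Y -> / 2 <= c <= 1 ->
  f * (a ^ 2 + b ^ 2) + s ^ 2 / r - 4 * (s ^ 2 / r) <=
    9 * (r * a ^ 2 + Y * b ^ 2)
    - 4 * ((r * c * (a ^ 2 - b ^ 2) - s ^ 2 * c / r) * r / f - 2 * Y * s * b / f)
    + c * (a ^ 2 - b ^ 2) * (r + 2 * Y) - s ^ 2 * c / r.
Proof.
  intros Hr HY Hf Hc.
  assert (Hf0 : 0 < f) by lra.
  set (z := s ^ 2 / r).
  assert (Hz : 0 <= z) by (apply Rmult_le_pos; [nra|apply Rlt_le, Rinv_0_lt_compat, Hr]).
  set (k := r / f).
  assert (Hk : 0 < k <= 1).
  { split; [apply Rdiv_lt_0_compat; assumption|].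
    apply Rmult_le_reg_r with f; [exact Hf0|]. unfold k, Rdiv.
    rewrite Rmult_assoc, Rinv_l by lra. lra. }
  assert (Hrk : r - Y <= r * k).
  { assert (r - r * k = Y * k) by (unfold k; rewrite Hf; field; lra). nra. }
  (* Completing the square leaves [8 Y s^2 / f^2 = 8 z r Y / f^2], which is at most [2 z] because
     [4 r Y <= (r + Y)^2 = f^2]. *)
  assert (Hcross : 8 * (Y * s * b / f) >= - (2 * Y * b ^ 2) - 2 * z).
  { assert (H1 : 2 * Y * b ^ 2 + 8 * (Y * s * b / f) + 8 * (Y * s ^ 2 / f ^ 2)
      = 2 * Y * (b + 2 * s / f) ^ 2) by (field; lra).
    assert (H2 : 0 <= 2 * Y * (b + 2 * s / f) ^ 2)
      by (apply Rmult_le_pos; [lra|apply pow2_ge_0]).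
    assert (H3 : 8 * (Y * s ^ 2 / f ^ 2) = 2 * z - 2 * z * ((r - Y) / f) ^ 2)
      by (unfold z; rewrite Hf; field; lra).
    assert (H4 : 0 <= 2 * z * ((r - Y) / f) ^ 2)
      by (apply Rmult_le_pos; [lra|apply pow2_ge_0]).
    lra. }
  replace (9 * (r * a ^ 2 + Y * b ^ 2)
    - 4 * ((r * c * (a ^ 2 - b ^ 2) - s ^ 2 * c / r) * r / f - 2 * Y * s * b / f)
    + c * (a ^ 2 - b ^ 2) * (r + 2 * Y) - s ^ 2 * c / r)
    with ((9 * r - 4 * c * (r * k) + c * r + 2 * c * Y) * a ^ 2
      + (9 * Y + 4 * c * (r * k) - c * r - 2 * c * Y) * b ^ 2
      + 4 * c * z * k - c * z + 8 * (Y * s * b / f))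
    by (unfold z, k; field; lra).
  assert (Ha : (r + Y) * a ^ 2 <= (9 * r - 4 * c * (r * k) + c * r + 2 * c * Y) * a ^ 2).
  { apply Rmult_le_compat_r; [nra|].
    assert (r * k <= r) by nra. assert (c * (r * k) <= 1 * r)
      by (apply Rmult_le_compat; nra).
    assert (0 <= (2 * c - 1) * Y) by (apply Rmult_le_pos; lra).
    assert (0 <= c * r) by nra. lra. }
  assert (Hb : (r + Y + 2 * Y) * b ^ 2
    <= (9 * Y + 4 * c * (r * k) - c * r - 2 * c * Y) * b ^ 2).
  { apply Rmult_le_compat_r; [nra|].
    assert (c * (r - Y) <= c * (r * k)) by (apply Rmult_le_compat_l; lra).
    assert (0 <= (6 - 6 * c) * Y) by (apply Rmult_le_pos; lra).
    assert (0 <= (2 * c - 1) * r) by (apply Rmult_le_pos; lra). nra. }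
  assert (0 <= c * z * k) by (apply Rmult_le_pos; [nra|lra]).
  assert (c * z <= 1 * z) by (apply Rmult_le_compat_r; lra).
  replace (f * (a ^ 2 + b ^ 2)) with ((r + Y) * a ^ 2 + (r + Y) * b ^ 2)
    by (rewrite Hf; ring).
  fold z. lra.
Qed.

(** Expansion of [(r + 2 alpha^2 K) (2 K r)], the product of the bounds on [rF] and [sin^2 u], with
    one factor [r] estimated by [T0 / 2]. *)
Definition C4 : R := K * T0 + 4 * alpha ^ 2 * K ^ 2.

Lemma C4_pos : 0 < T0 -> 0 < C4.
Proof.
  intro HT0. assert (H := K_pos HT0). unfold C4.
  assert (0 < alpha ^ 2) by nra. assert (0 < K ^ 2) by nra. nra.
Qed.

Lemma rF_sin_sqr_le t r : 0 < t <= T0 / 2 -> 0 < r <= t ->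
  0 <= rF t r * sin (u t r) ^ 2 <= C4 * r.
Proof.
  intros Ht Hr. assert (Hs := sin_sqr_le t r Ht Hr).
  assert (HF := rF_ge t r (proj1 Hr)).
  assert (HK : 0 < K) by (apply K_pos; lra).
  split; [apply Rmult_le_pos; nra|].
  set (q := sin (u t r) ^ 2) in *. assert (Hq : 0 <= q) by (unfold q; nra).
  assert (HrF : rF t r <= r + alpha ^ 2 * (2 * K)).
  { unfold rF. fold q. apply Rplus_le_compat_l. unfold Rdiv. rewrite Rmult_assoc.
    apply Rmult_le_compat_l; [nra|]. apply Rmult_le_reg_r with r; [lra|].
    rewrite Rmult_assoc, Rinv_l by lra. lra. }
  apply Rle_trans with ((r + alpha ^ 2 * (2 * K)) * (2 * K * r)).
  - apply Rmult_le_compat; lra.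
  - unfold C4. assert (0 < alpha ^ 2) by nra. assert (0 < K * r) by nra. nra.
Qed.

Lemma rF_sin_le t r z b : 0 < t <= T0 / 2 -> 0 < r <= t -> 0 < b ->
  Rabs (rF t r * z * sin (u t r)) <= b * (rF t r * z ^ 2 / 2) + C4 * r / (2 * b).
Proof.
  intros Ht Hr Hb. assert (H := rF_sin_sqr_le t r Ht Hr).
  assert (HF := rF_ge t r (proj1 Hr)).
  set (s := sin (u t r)) in *. set (f := rF t r) in *.
  assert (Hib : 0 < / (2 * b)) by (apply Rinv_0_lt_compat; lra).
  apply Rle_trans with (b * (f * z ^ 2 / 2) + f * s ^ 2 * / (2 * b)).
  - assert (H1 : b * (f * z ^ 2 / 2) + f * s ^ 2 * / (2 * b) - f * z * s
      = f * / (2 * b) * (b * z - s) ^ 2) by (field; lra).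
    assert (H2 : b * (f * z ^ 2 / 2) + f * s ^ 2 * / (2 * b) + f * z * s
      = f * / (2 * b) * (b * z + s) ^ 2) by (field; lra).
    assert (0 <= f * / (2 * b) * (b * z - s) ^ 2)
      by (apply Rmult_le_pos; [nra|apply pow2_ge_0]).
    assert (0 <= f * / (2 * b) * (b * z + s) ^ 2)
      by (apply Rmult_le_pos; [nra|apply pow2_ge_0]).
    apply Rabs_le. lra.
  - apply Rplus_le_compat_l. apply Rmult_le_compat_r; lra.
Qed.

Lemma r_sin_le_rF_sin t r z : 0 < r ->
  Rabs (r * sin (u t r) * z) <= Rabs (rF t r * z * sin (u t r)).
Proof.
  intro Hr. assert (H := rF_ge t r Hr).
  rewrite !Rabs_mult, (Rabs_pos_eq r), (Rabs_pos_eq (rF t r)) by lra.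
  assert (H1 := Rabs_pos (sin (u t r))). assert (H2 := Rabs_pos z).
  assert (0 <= Rabs (sin (u t r)) * Rabs z) by (apply Rmult_le_pos; assumption). nra.
Qed.

(** The [5 = 4 + 1] counts the two terms with [sin u], each split by Young's inequality. The free
    [b] trades energy against a remainder without derivatives. *)
Lemma morawetz_le t r b : 0 < t <= T0 / 2 -> 0 < r <= t -> 0 < b ->
  Rabs (morawetz t r) <= (9 * r + 5 * b) * e t r + 5 * (C4 * r / (2 * b)).
Proof.
  intros Ht Hr Hb. assert (HF := rF_ge t r (proj1 Hr)).
  assert (H1 := rF_sin_le t r (ut t r) b Ht Hr Hb).
  assert (H2 := r_sin_le_rF_sin t r (ut t r) (proj1 Hr)).
  assert (He := energy_density_split t r (proj1 Hr)).
  assert (Hs := sin_sqr_div_ge0 t r (proj1 Hr)).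
  assert (Hut : rF t r * ut t r ^ 2 / 2 <= e t r).
  { assert (0 <= rF t r * ur t r ^ 2) by (apply Rmult_le_pos; nra). nra. }
  assert (Hm : Rabs (r * rF t r * ut t r * ur t r) <= r * e t r).
  { replace (r * rF t r * ut t r * ur t r) with (r * (rF t r * (ut t r * ur t r))) by ring.
    rewrite Rabs_mult, (Rabs_pos_eq r) by lra. apply Rmult_le_compat_l; [lra|].
    rewrite Rabs_mult, (Rabs_pos_eq (rF t r)) by lra.
    apply Rle_trans with (rF t r * ((ut t r ^ 2 + ur t r ^ 2) / 2)); [|lra].
    apply Rmult_le_compat_l; [lra|].
    assert (0 <= (ut t r - ur t r) ^ 2) by apply pow2_ge_0.
    assert (0 <= (ut t r + ur t r) ^ 2) by apply pow2_ge_0.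
    apply Rabs_le. nra. }
  assert (Hbe : b * (rF t r * ut t r ^ 2 / 2) <= b * e t r)
    by (apply Rmult_le_compat_l; lra).
  unfold morawetz.
  apply Rabs_le_between in Hm.
  assert (H3 := Rle_trans _ _ _ H2 H1). apply Rabs_le_between in H3.
  apply Rabs_le_between in H1. apply Rabs_le. lra.
Qed.

Lemma morawetz_ex_RInt t a b : 0 < t <= T0 -> 0 < a -> a <= b -> b <= t ->
  ex_RInt (morawetz t) a b.
Proof.
  intros Ht Ha Hab Hb.
  destruct morawetz_balance as (At & Ar & _ & _ & HA & _).
  apply (C1on_section_ex_RInt off_axis morawetz At Ar t a b HA Hab).
  intros r Hr. apply cone_off_axis; lra.
Qed.

Lemma morawetz_piece_le t a b c1 c2 : 0 < t <= T0 -> 0 < a -> a <= b -> b <= t ->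
  (forall r, a < r < b -> Rabs (morawetz t r) <= c1 * e t r + c2) ->
  Rabs (RInt (morawetz t) a b) <= c1 * RInt (e t) a b + c2 * (b - a).
Proof.
  intros Ht Ha Hab Hb H.
  assert (He : ex_RInt (e t) a b) by (apply energy_density_ex_RInt; lra).
  assert (Hm : ex_RInt (morawetz t) a b) by (apply morawetz_ex_RInt; assumption).
  assert (Hg : is_RInt (fun r => c1 * e t r + c2) a b
    (c1 * RInt (e t) a b + c2 * (b - a))).
  { evar_last.
    - apply (@is_RInt_plus R_NormedModule).
      + apply (@is_RInt_scal R_NormedModule).
        apply (@RInt_correct R_CompleteNormedModule), He.
      + apply (@is_RInt_const R_NormedModule).
    - unfold plus, scal; simpl; unfold mult; simpl. apply f_equal. apply Rmult_comm. }
  apply Rabs_le. rewrite <- (is_RInt_unique _ _ _ _ Hg). split.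
  - rewrite <- (@RInt_opp R_CompleteNormedModule) by (eexists; exact Hg).
    apply RInt_le; [exact Hab| |exact Hm|].
    + apply (@ex_RInt_opp R_NormedModule). eexists; exact Hg.
    + intros x Hx. specialize (H x Hx). apply Rabs_le_between in H. apply H.
  - apply RInt_le; [exact Hab|exact Hm|eexists; exact Hg|].
    intros x Hx. specialize (H x Hx). apply Rabs_le_between in H. apply H.
Qed.

(** Inside [r < lam t] take [b = lam t]: the energy has the small coefficient [14 lam t]
    ([14 = 9 + 5]), and the remainder is bounded on an interval of length at most [lam t]. Outside
    take [b = t / lam]: the remainder is of order [lam], and the large coefficient falls on the
    exterior energy, which decays. *)
Lemma morawetz_integral_le lam t eps : 0 < lam < 1 -> 0 < t <= T0 / 2 -> 0 < eps < lam * t ->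
  Rabs (RInt (morawetz t) eps t) <=
    t * (14 * lam * E (T0 / 2) + 14 / lam * RInt (e t) (lam * t) t + 5 * C4 * lam).
Proof.
  intros Hlam Ht Heps.
  assert (Hlt : 0 < lam * t < t) by nra.
  assert (HC := C4_pos ltac:(lra)).
  assert (Hsplit : RInt (morawetz t) eps t
    = RInt (morawetz t) eps (lam * t) + RInt (morawetz t) (lam * t) t).
  { symmetry. apply (@RInt_Chasles R_CompleteNormedModule); apply morawetz_ex_RInt; lra. }
  rewrite Hsplit. eapply Rle_trans; [apply Rabs_triang|].
  assert (H1 : Rabs (RInt (morawetz t) eps (lam * t))
    <= 14 * (lam * t) * RInt (e t) eps (lam * t) + 5 / 2 * C4 * (lam * t - eps)).
  { apply morawetz_piece_le; try lra. intros r Hr.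
    eapply Rle_trans; [apply (morawetz_le t r (lam * t)); lra|].
    apply Rplus_le_compat.
    - apply Rmult_le_compat_r; [apply energy_density_ge0|]; lra.
    - replace (5 / 2 * C4) with (5 * (C4 * (lam * t) / (2 * (lam * t)))) by (field; lra).
      apply Rmult_le_compat_l; [lra|].
      apply Rmult_le_compat_r; [apply Rlt_le, Rinv_0_lt_compat; lra|].
      apply Rmult_le_compat_l; lra. }
  assert (Htl : 0 < t / lam) by (apply Rdiv_lt_0_compat; lra).
  assert (Htl1 : t <= t / lam).
  { apply Rmult_le_reg_r with lam; [lra|]. unfold Rdiv.
    rewrite Rmult_assoc, Rinv_l by lra. nra. }
  assert (H2 : Rabs (RInt (morawetz t) (lam * t) t)
    <= 14 * (t / lam) * RInt (e t) (lam * t) t + 5 / 2 * C4 * lam * (t - lam * t)).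
  { apply morawetz_piece_le; try lra. intros r Hr.
    eapply Rle_trans; [apply (morawetz_le t r (t / lam)); lra|].
    apply Rplus_le_compat.
    - apply Rmult_le_compat_r; [apply energy_density_ge0|]; lra.
    - replace (5 / 2 * C4 * lam) with (5 * (C4 * t / (2 * (t / lam)))) by (field; lra).
      apply Rmult_le_compat_l; [lra|].
      apply Rmult_le_compat_r; [apply Rlt_le, Rinv_0_lt_compat; lra|].
      apply Rmult_le_compat_l; lra. }
  assert (HE : RInt (e t) eps (lam * t) <= E (T0 / 2)).
  { apply Rle_trans with (E t); [|apply energy_mono; lra].
    assert (Hs1 : E t = RInt (e t) 0 eps + RInt (e t) eps t).
    { unfold E. symmetry.
      apply (@RInt_Chasles R_CompleteNormedModule); apply energy_density_ex_RInt; lra. }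
    assert (Hs2 : RInt (e t) eps t
      = RInt (e t) eps (lam * t) + RInt (e t) (lam * t) t).
    { symmetry.
      apply (@RInt_Chasles R_CompleteNormedModule); apply energy_density_ex_RInt; lra. }
    assert (0 <= RInt (e t) 0 eps).
    { apply RInt_ge_0; [lra|apply energy_density_ex_RInt; lra|].
      intros x Hx. apply energy_density_ge0. lra. }
    assert (0 <= RInt (e t) (lam * t) t).
    { apply RInt_ge_0; [lra|apply energy_density_ex_RInt; lra|].
      intros x Hx. apply energy_density_ge0. lra. }
    lra. }
  assert (H3 : 14 * (lam * t) * RInt (e t) eps (lam * t)
    <= 14 * (lam * t) * E (T0 / 2)) by (apply Rmult_le_compat_l; lra).
  assert (H4 : 5 / 2 * C4 * (lam * t - eps) <= 5 / 2 * C4 * (lam * t))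
    by (apply Rmult_le_compat_l; lra).
  assert (H5 : 5 / 2 * C4 * lam * (t - lam * t) <= 5 / 2 * C4 * lam * t)
    by (apply Rmult_le_compat_l; nra).
  replace (t * (14 * lam * E (T0 / 2) + 14 / lam * RInt (e t) (lam * t) t + 5 * C4 * lam))
    with (14 * (lam * t) * E (T0 / 2) + 14 * (t / lam) * RInt (e t) (lam * t) t
      + 5 * C4 * (lam * t)) by (field; lra).
  lra.
Qed.

(** [K t <= / 2] forces [cos u >= / 2], as the algebraic inequality requires; its loss
    [4 sin^2 u / r] is at most [8 K]. *)
Lemma morawetz_source_ge t r : 0 < t <= T0 / 2 -> K * t <= / 2 -> 0 < r <= t ->
  2 * e t r - 8 * K <= morawetz_source t r.
Proof.
  intros Ht HKt Hr.
  assert (HK : 0 < K) by (apply K_pos; lra).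
  assert (Hc1 := one_minus_cos_le t r Ht Hr).
  assert (Hc2 := COS_bound (u t r)).
  assert (HKr : K * r <= K * t) by (apply Rmult_le_compat_l; lra).
  assert (H := morawetz_source_algebra r (rF t r) (alpha ^ 2 * sin (u t r) ^ 2 / r)
    (sin (u t r)) (cos (u t r)) (ut t r) (ur t r)).
  assert (Hz : sin (u t r) ^ 2 / r <= 2 * K).
  { apply Rmult_le_reg_r with r; [lra|]. unfold Rdiv.
    rewrite Rmult_assoc, Rinv_l by lra.
    assert (Hs := sin_sqr_le t r Ht Hr). lra. }
  rewrite energy_density_split by lra.
  replace (2 * (rF t r * (ut t r ^ 2 + ur t r ^ 2) / 2 + sin (u t r) ^ 2 / (2 * r)))
    with (rF t r * (ut t r ^ 2 + ur t r ^ 2) + sin (u t r) ^ 2 / r) by (field; lra).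
  apply Rle_trans with (rF t r * (ut t r ^ 2 + ur t r ^ 2) + sin (u t r) ^ 2 / r
    - 4 * (sin (u t r) ^ 2 / r)); [lra|].
  apply H; [lra| |reflexivity|lra].
  apply Rmult_le_pos; [nra|apply Rlt_le, Rinv_0_lt_compat; lra].
Qed.

(** On [r = t] density and flux combine so that derivatives enter only through [u_t + u_r], which
    [cone_flux] controls. Young's inequality with [b = t / th] leaves [5 th C4 / 2], rounded up to
    [3 th C4]. *)
Lemma morawetz_cone_ge t th : 0 < t <= T0 / 2 -> 0 < th ->
  - ((9 + 5 / th) * (t * cone_flux t)) - 3 * th * C4 <= morawetz t t + morawetz_flux t t.
Proof.
  intros Ht Hth.
  assert (HC := C4_pos ltac:(lra)).
  assert (Hf := cone_flux_ge t (proj1 Ht)).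
  set (p := ut t t + ur t t) in *.
  replace (morawetz t t + morawetz_flux t t) with
    (-9 * (t * (rF t t * p ^ 2 / 2)) + 9 * (sin (u t t) ^ 2 / 2)
     - 4 * (t * sin (u t t) * p) + rF t t * p * sin (u t t))
    by (unfold morawetz, morawetz_flux, p; field).
  assert (Htt : 0 < t <= t) by lra.
  assert (Hb : 0 < t / th) by (apply Rdiv_lt_0_compat; lra).
  assert (H1 := rF_sin_le t t p (t / th) Ht Htt Hb).
  assert (H2 := Rle_trans _ _ _ (r_sin_le_rF_sin t t p (proj1 Ht)) H1).
  replace (C4 * t / (2 * (t / th))) with (th * C4 / 2) in H1, H2 by (field; lra).
  replace (t / th * (rF t t * p ^ 2 / 2)) with (/ th * (t * (rF t t * p ^ 2 / 2)))
    in H1, H2 by (field; lra).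
  apply Rabs_le_between in H1. apply Rabs_le_between in H2.
  assert (Hith : 0 < / th) by (apply Rinv_0_lt_compat, Hth).
  assert (H3 : (9 + 5 * / th) * (t * (rF t t * p ^ 2 / 2))
    <= (9 + 5 * / th) * (t * cone_flux t)).
  { apply Rmult_le_compat_l; [lra|]. apply Rmult_le_compat_l; lra. }
  assert (0 <= sin (u t t) ^ 2) by nra.
  assert (0 < th * C4) by nra.
  unfold Rdiv at 1. lra.
Qed.

(** * Integration over [[T, 2 T]] and conclusion *)

Lemma le_of_linear_bound (x y c d : R) : 0 < d ->
  (forall eps, 0 < eps <= d -> x <= y + c * eps) -> x <= y.
Proof.
  intros Hd H. destruct (Rle_dec x y) as [?|Hn]; [assumption|]. exfalso.
  enough (x - y = 0) by lra.
  apply (eq_of_linear_bound _ _ c d Hd). intros eps Heps.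
  rewrite Rminus_0_r, Rabs_pos_eq by lra. specialize (H eps Heps). lra.
Qed.

(** The loss on the cone is paid by [k x (E x - E T)]. This vanishes at [x = T] and at [x = 2 T] is
    [T] times an oscillation of [E], so the whole right side is [o(T)] once the parameters are
    chosen. *)
Lemma energy_bound lam th T :
  0 < lam < 1 -> 0 < th -> 0 < T -> 2 * T <= T0 / 2 -> K * (2 * T) <= / 2 ->
  2 * E T * T <=
    T * (14 * lam * E (T0 / 2) + 14 / lam * RInt (e T) (lam * T) T + 5 * C4 * lam)
    + 2 * T * (14 * lam * E (T0 / 2)
        + 14 / lam * RInt (e (2 * T)) (lam * (2 * T)) (2 * T) + 5 * C4 * lam)
    + (9 + 5 / th) * (2 * T * (E (2 * T) - E T)) + (3 * th * C4 + 16 * K * T) * T.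
Proof.
  intros Hlam Hth HT HT2 HKT.
  assert (HK : 0 < K) by (apply K_pos; lra).
  destruct (axis_terms T (2 * T)) as [C [HC Hax]]; try lra.
  destruct (energy_near_axis T (2 * T)) as [C' [HC' Hnear]]; try lra.
  assert (HlT : 0 < lam * T < T) by nra.
  apply (le_of_linear_bound _ _ ((C + 2 * C') * T) (lam * T / 2)); [lra|].
  intros eps Heps.
  assert (N1 := morawetz_integral_le lam T eps).
  assert (N2 := morawetz_integral_le lam (2 * T) eps).
  assert (Hith : 0 < / th) by (apply Rinv_0_lt_compat, Hth).
  set (k := 9 + 5 / th). assert (Hk : 0 < k) by (unfold k, Rdiv; lra).
  (* The positive terms cover the errors on the cone, in the source and at the cut [r = eps].
     Subtracting [2 E T] leaves [2 (E x - E T) >= 0] in the derivative and places [2 E T * T] in the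
     final inequality. *)
  set (m := 3 * th * C4 + 16 * K * T + (C + 2 * C') * eps - 2 * E T).
  assert (Hmono : RInt (morawetz T) eps T + k * (T * (E T - E T)) + m * T
    <= RInt (morawetz (2 * T)) eps (2 * T) + k * (2 * T * (E (2 * T) - E T)) + m * (2 * T)).
  { apply (nondecreasing_of_derive
      (fun x => RInt (morawetz x) eps x + k * (x * (E x - E T)) + m * x)); [lra|].
    intros x Hx.
    destruct (balance_slice _ _ _ (fun _ => eps) (fun x => x) 0 1 x morawetz_balance)
      as [Hex HN]; try lra.
    { apply (@is_derive_const R_AbsRing). }
    { apply (@is_derive_id R_AbsRing). }
    cbv beta in Hex, HN.
    exists (morawetz x x * 1 - morawetz x eps * 0 + morawetz_flux x x - morawetz_flux x eps
      + RInt (morawetz_source x) eps x + k * (E x - E T + x * cone_flux x) + m).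
    split.
    - apply (@is_derive_plus R_AbsRing R_NormedModule).
      + apply (@is_derive_plus R_AbsRing R_NormedModule); [exact HN|].
        apply is_derive_scal. evar_last.
        * apply (@is_derive_mult R_AbsRing (fun x => x) (fun x => E x - E T) x 1).
          -- apply (@is_derive_id R_AbsRing).
          -- apply (@is_derive_minus R_AbsRing R_NormedModule);
               [apply energy_derive; lra|apply (@is_derive_const R_AbsRing)].
          -- exact Rmult_comm.
        * unfold minus, plus, opp, zero, mult; simpl. ring.
      + auto_derive; [auto|ring].
    - assert (HS : 2 * RInt (e x) eps x - 8 * K * (x - eps) <= RInt (morawetz_source x) eps x).
      { assert (He : ex_RInt (e x) eps x) by (apply energy_density_ex_RInt; lra).
        assert (Hi : is_RInt (fun r => 2 * e x r - 8 * K) eps x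
          (2 * RInt (e x) eps x - 8 * K * (x - eps))).
        { evar_last.
          - apply (@is_RInt_minus R_NormedModule).
            + apply (@is_RInt_scal R_NormedModule).
              apply (@RInt_correct R_CompleteNormedModule), He.
            + apply (@is_RInt_const R_NormedModule).
          - unfold minus, plus, opp, scal; simpl; unfold mult; simpl.
            unfold Rminus. rewrite (Rmult_comm (8 * K)). reflexivity. }
        rewrite <- (is_RInt_unique _ _ _ _ Hi).
        apply RInt_le; [lra|eexists; exact Hi|exact Hex|].
        intros r Hr. apply morawetz_source_ge; try lra.
        apply Rle_trans with (K * (2 * T)); [apply Rmult_le_compat_l; lra|exact HKT]. }
      assert (Hcone := morawetz_cone_ge x th).
      assert (Hn := Hnear x eps).
      destruct (Hax x eps) as [_ [_ Hfl]]; [lra|lra|].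
      apply Rabs_le_between in Hfl.
      assert (HE : E T <= E x) by (apply energy_mono; lra).
      assert (HkE : 0 <= k * (E x - E T)) by (apply Rmult_le_pos; lra).
      assert (HKx : 8 * K * (x - eps) <= 16 * K * T).
      { replace (16 * K * T) with (8 * K * (2 * T)) by ring.
        apply Rmult_le_compat_l; lra. }
      unfold m. fold k in Hcone.
      replace (k * (E x - E T + x * cone_flux x))
        with (k * (E x - E T) + k * (x * cone_flux x)) by ring.
      lra. }
  assert (A1 : Rabs (RInt (morawetz T) eps T) <=
    T * (14 * lam * E (T0 / 2) + 14 / lam * RInt (e T) (lam * T) T + 5 * C4 * lam))
    by (apply N1; lra).
  assert (A2 : Rabs (RInt (morawetz (2 * T)) eps (2 * T)) <=
    2 * T * (14 * lam * E (T0 / 2)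
      + 14 / lam * RInt (e (2 * T)) (lam * (2 * T)) (2 * T) + 5 * C4 * lam))
    by (apply N2; nra).
  apply Rabs_le_between in A1. apply Rabs_le_between in A2.
  unfold m in Hmono. lra.
Qed.

Lemma energy_vanishes eps : 0 < T0 -> 0 < eps ->
  exists d, 0 < d <= T0 /\ forall T, 0 < T < d -> E T < eps.
Proof.
  intros HT0 Heps.
  assert (HK := K_pos HT0). assert (HC := C4_pos HT0).
  assert (HE := energy_ge0 (T0 / 2) ltac:(lra)).
  (* Collects everything proportional to [lam] when [th = lam]; the [3 = 1 + 2] comes from the
     boundary terms at [T] and [2 T]. *)
  set (G := 3 * (14 * E (T0 / 2) + 14 + 5 * C4) + 3 * C4).
  assert (HG : 0 < G) by (unfold G; lra).
  set (lam := Rmin (/ 2) (eps / (4 * G))).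
  assert (Hl0 : 0 < lam) by (apply Rmin_pos; [lra|apply Rdiv_lt_0_compat; lra]).
  assert (Hl1 : lam <= / 2) by apply Rmin_l.
  assert (Hl2 : lam * G <= eps / 4).
  { apply Rle_trans with (eps / (4 * G) * G).
    - apply Rmult_le_compat_r; [lra|apply Rmin_r].
    - right. field. lra. }
  assert (Hil : 0 < 5 / lam) by (apply Rdiv_lt_0_compat; lra).
  set (o := eps / (8 * (9 + 5 / lam))).
  assert (Ho : 0 < o) by (apply Rdiv_lt_0_compat; lra).
  destruct (energy_oscillation o HT0 Ho) as [d1 [Hd1 Hosc]].
  (* Smallness [lam ^ 2] compensates the coefficient [14 / lam] of the exterior energy. In the end
     [2 E T] is at most three contributions of [eps / 4]. *)
  destruct (exterior_decay lam (lam ^ 2) HT0) as [d2 [Hd2 Hext]]; [lra|nra|].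
  set (d3 := Rmin (/ (4 * K)) (eps / (64 * K))).
  assert (Hd3 : 0 < d3).
  { apply Rmin_pos; [apply Rinv_0_lt_compat; lra|apply Rdiv_lt_0_compat; lra]. }
  set (d := Rmin (d1 / 2) (Rmin (d2 / 2) d3)).
  assert (M1 : d <= d1 / 2) by apply Rmin_l.
  assert (M2 : d <= d2 / 2)
    by (eapply Rle_trans; [apply Rmin_r|apply Rmin_l]).
  assert (M3 : d <= d3) by (eapply Rle_trans; [apply Rmin_r|apply Rmin_r]).
  assert (M4 : d3 <= / (4 * K)) by apply Rmin_l.
  assert (M5 : d3 <= eps / (64 * K)) by apply Rmin_r.
  exists d. split; [split; [repeat apply Rmin_pos; lra|lra]|].
  intros T HT.
  assert (HKT : K * T <= / 4).
  { apply Rle_trans with (K * / (4 * K)).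
    - apply Rmult_le_compat_l; lra.
    - right. field. lra. }
  assert (HKT2 : 16 * K * T <= eps / 4).
  { apply Rle_trans with (16 * K * (eps / (64 * K))).
    - apply Rmult_le_compat_l; lra.
    - right. field. lra. }
  assert (H := energy_bound lam lam T).
  assert (X1 := Hext T ltac:(lra)). assert (X2 := Hext (2 * T) ltac:(lra)).
  assert (Hosc' := Hosc T (2 * T) ltac:(lra) ltac:(lra) ltac:(lra)).
  assert (Y : forall x, x <= lam ^ 2 -> 14 / lam * x <= 14 * lam).
  { intros x Hx. apply Rle_trans with (14 / lam * lam ^ 2).
    - apply Rmult_le_compat_l; [|exact Hx].
      apply Rlt_le, Rdiv_lt_0_compat; lra.
    - right. field. lra. }
  apply Y in X1. apply Y in X2.
  set (B := 14 * lam * E (T0 / 2) + 14 * lam + 5 * C4 * lam).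
  assert (Hfin : 2 * E T * T <=
    (3 * B + 2 * ((9 + 5 / lam) * o) + (3 * lam * C4 + 16 * K * T)) * T).
  { eapply Rle_trans; [apply H; lra|].
    assert (Z1 : T * (14 * lam * E (T0 / 2) + 14 / lam * RInt (e T) (lam * T) T
      + 5 * C4 * lam) <= T * B) by (apply Rmult_le_compat_l; unfold B; lra).
    assert (Z2 : 2 * T * (14 * lam * E (T0 / 2)
        + 14 / lam * RInt (e (2 * T)) (lam * (2 * T)) (2 * T) + 5 * C4 * lam)
      <= 2 * T * B) by (apply Rmult_le_compat_l; unfold B; lra).
    assert (Z3 : (9 + 5 / lam) * (2 * T * (E (2 * T) - E T))
      <= (9 + 5 / lam) * (2 * T * o)).
    { apply Rmult_le_compat_l; [lra|]. apply Rmult_le_compat_l; lra. }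
    lra. }
  apply Rmult_le_reg_r in Hfin; [|lra].
  replace ((9 + 5 / lam) * o) with (eps / 8) in Hfin
    by (unfold o; field; split; lra).
  assert (3 * B + 3 * lam * C4 = lam * G) by (unfold B, G; ring).
  lra.
Qed.

End Skyrme.

Theorem theorem1 (alpha T0 : R) (u : R -> R -> R)
  (D : nat -> nat -> R -> R -> R) :
  0 < alpha -> 0 < T0 ->
  smooth_on_Omega T0 u D ->
  (forall t r, 0 < t <= T0 -> 0 < r <= t -> skyrme_eq alpha D t r) ->
  (forall t, 0 < t <= T0 -> u t 0 = 0) ->
  exists E : R -> R,
    (forall T, 0 < T <= T0 ->
       exists pr : Riemann_integrable (energy_density alpha D T) 0 T,
         RiemannInt pr = E T) /\
    (forall eps, 0 < eps -> exists delta, 0 < delta /\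
       forall T, 0 < T < delta -> T <= T0 -> Rabs (E T) < eps).
Proof.
  intros Halpha HT0 [U [HU [HOm [HD Hu]]]] Hpde Haxis.
  assert (HaxisD : forall t, 0 < t <= T0 -> D 0%nat 0%nat t 0 = 0).
  { intros t Ht. rewrite Hu by (apply HOm; unfold Omega; lra). apply Haxis, Ht. }
  exists (E alpha D). split.
  - intros T HT.
    assert (Hex : ex_RInt (energy_density alpha D T) 0 T)
      by (eapply energy_density_ex_RInt; eauto; lra).
    exists (ex_RInt_Reals_0 _ _ _ Hex). symmetry. apply RInt_Reals.
  - intros eps Heps.
    destruct (energy_vanishes alpha T0 D U Halpha HU HOm HD Hpde HaxisD eps HT0 Heps)
      as [d [Hd H]].
    exists d. split; [lra|]. intros T HT HTT0.
    rewrite Rabs_pos_eq; [apply H, HT|].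
    eapply energy_ge0; eauto; lra.
Qed.
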